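(* Let $P$ be a precompact Hausdorff abelian topological group. Then $\mathfrak{l}_P(H)=\bar H^\delta$ for every subgroup $H\leq P$, where $\bar H^\delta$ is the $G_\delta$-closure of $H$ in $P$. In other words, $\mathfrak{l}$ coincides with the $G_\delta$-closure on precompact Hausdorff abelian groups.
   Context: $\mathbb{T}=\mathbb{R}/\mathbb{Z}$; $\hat G$ is the Pontryagin dual of an abelian topological group $G$. A topological group $G$ is precompact if for every neighborhood $U$ of the identity there is a finite $F\subseteq G$ with $G=FU$. For a topological group $G$, $\mathcal{C}(G)$ is the set of all filter-bases on $G$ that contain (as a member) a countable subset of $G$. For a filter-base $\mathcal{F}$ on $\hat G$, put $z_{\mathcal{F}}(G)=\{\chi\in G\mid \chi(\mathcal{F})\longrightarrow 0\text{ in }\mathbb{T}\}$, where $\chi\in G$ is regarded as the character $x\mapsto x(\chi)$ of $\hat G$ and $\chi(\mathcal{F})=\{\chi(F)\mid F\in\mathcal{F}\}$. For an abelian topological group $G$ and $H\leq G$, $$\mathfrak{l}_G(H)=\bigcap\{z_{\mathcal{F}}(G)\mid \mathcal{F}\in\mathcal{C}(\hat G),\ H\leq z_{\mathcal{F}}(G)\}.$$ The $G_\delta$-closure $\bar Y^\delta$ of a subset $Y$ of a topological space $X$ consists of all $x\in X$ such that every $G_\delta$-set containing $x$ meets $Y$. *)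

(* Defs.v *)
From HB Require Import structures.
From mathcomp Require Import all_boot all_order all_algebra.
From mathcomp Require Import all_classical all_reals all_analysis.
From mathcomp Require Import borel_hierarchy.

Set Implicit Arguments.
Unset Strict Implicit.
Unset Printing Implicit Defensive.

Import Order.TTheory GRing.Theory Num.Theory.
Import numFieldNormedType.Exports.

Local Open Scope classical_set_scope.
Local Open Scope ring_scope.
Local Open Scope quotient_scope.

Definition Rint_subgroup (R : realType) : zmodClosed R :=
  GRing.ZmodClosed.clone R (@Rint_pred R) _.

(* R/Z as a topological group: the quotient group with the quotient topology. *)
Definition circle (R : realType) : Type :=
  quotient_topology (ring_quotient.Quotient.quot (Rint_subgroup R)).

HB.instance Definition _ (R : realType) := Topological.on (circle R).
HB.instance Definition _ (R : realType) := Quotient.on (circle R).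
HB.instance Definition _ (R : realType) :=
  @Algebra.isZmodule.Build (circle R) _ _ _
    (@ring_quotient.Quotient.addqA R (Rint_subgroup R))
    (@ring_quotient.Quotient.addqC R (Rint_subgroup R))
    (@ring_quotient.Quotient.add0q R (Rint_subgroup R))
    (@ring_quotient.Quotient.addNq R (Rint_subgroup R)).

Section circle_theory.
Variable R : realType.
Local Notation pi := (\pi_(circle R)).

Lemma circle_piB : {morph pi : x y / x - y}.
Proof.
move=> x y; rewrite (@ring_quotient.Quotient.pi_add R (Rint_subgroup R)).
by rewrite (@ring_quotient.Quotient.pi_opp R (Rint_subgroup R)).
Qed.

Lemma circle_piP (x y : R) : reflect (pi x = pi y) (x - y \is a Rint).
Proof.
have E := @ring_quotient.Quotient.idealrBE R (Rint_subgroup R) x y.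
have {}E : (x - y \is a Rint) <-> pi x = pi y.
  split=> [xy|xy]; first by have /eqP := etrans (esym E) xy.
  apply: etrans E _.
  exact: (introT (@eqP (ring_quotient.Quotient.quot (Rint_subgroup R)) _ _) xy).
by apply: (iffP idP) => /E.
Qed.

Lemma circle_pi_open (U : set R) : open U -> open (pi @` U).
Proof.
move=> oU.
have -> : open (pi @` U) = open (pi @^-1` (pi @` U)) by [].
have -> : pi @^-1` (pi @` U) =
    \bigcup_(z in [set z : R | z \is a Rint]) ((fun x : R => x + z) @^-1` U).
  apply/seteqP; split=> x /=.
    case=> u Uu /circle_piP Ruz.
    by exists (u - x) => //=; rewrite addrC subrK.
  case=> z /= Rz Uxz; exists (x + z) => //; apply/circle_piP.
  by rewrite addrAC subrr add0r.
apply: bigcup_open => z _; apply: open_comp => // x _.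
by apply: cvgD; [exact: cvg_id|exact: cvg_cst].
Qed.

Lemma circle_sub_continuous :
  continuous (fun x : circle R * circle R => x.1 - x.2).
Proof.
move=> [a b] /=.
rewrite -(reprK a) -(reprK b); set x := repr a; set y := repr b.
move=> W /=; rewrite -circle_piB => nW.
have : nbhs (x, y) [set p : R * R | W (pi (p.1 - p.2))].
  have pc : {for x - y, continuous pi} by exact: pi_continuous.
  exact: (continuous_comp (@sub_continuous R^o (x, y)) pc).
case=> -[A B] /= [nA nB] AB.
exists (pi @` A°, pi @` B°).
  by split; apply: open_nbhs_nbhs; split;
    [apply: circle_pi_open; exact: open_interior | exists x
    |apply: circle_pi_open; exact: open_interior | exists y].
move=> [_ _] /= [[u Au <-] [v Bv <-]]; rewrite -circle_piB.
by apply: (AB (u, v)); split; exact: interior_subset.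
Qed.

End circle_theory.

HB.instance Definition _ (R : realType) :=
  PreTopologicalNmodule_isTopologicalZmodule.Build (circle R)
    (@circle_sub_continuous R).

Definition filter_base (X : Type) (FF : set (set X)) :=
  [/\ FF !=set0, (forall A, FF A -> A !=set0) &
      forall A B, FF A -> FF B -> exists2 C, FF C & C `<=` A `&` B].

(* [countable] includes the finite sets. *)
Definition countable_filter_bases (X : Type) : set (set (set X)) :=
  [set FF | filter_base FF /\ exists2 A, FF A & countable A].

(* Continuous homomorphisms G -> R/Z.  Neither the group law nor the topology
   of the dual matters for filter-bases on it and their images under
   evaluation maps, so only its elements are represented. *)
Record dual (R : realType) (G : topologicalZmodType) := Dual {
  dual_fun :> {additive G -> circle R};
  dual_continuous : continuous dual_fun }.

Section annihilators.
Variables (R : realType) (G : topologicalZmodType).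

(* [filter_from FF B] is the filter generated by the filter-base of the sets
   [B F], [F] in [FF]. *)
Definition z_set (FF : set (set (dual R G))) : set G :=
  [set chi : G |
    filter_from FF (fun F => [set x chi | x in F]) --> (0 : circle R)].

Definition frak_l (H : set G) : set G :=
  \bigcap_(FF in [set FF | countable_filter_bases FF /\
                           H `<=` z_set FF]) z_set FF.

End annihilators.

Definition Gdelta_closure (X : topologicalType) (Y : set X) : set X :=
  [set x | forall S, Gdelta S -> S x -> S `&` Y !=set0].

(* Not the library's [precompact], which means relatively compact. *)
Definition precompact_group (G : topologicalZmodType) :=
  forall U : set G, nbhs 0 U ->
    exists2 F : set G, finite_set F & setT = [set x + u | x in F & u in U].

(* Main.v *)
From HB Require Import structures.
Require Import Defs.
From mathcomp Require Import all_boot all_order all_algebra.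
From mathcomp Require Import all_classical all_reals all_analysis.
From mathcomp Require Import borel_hierarchy.
From mathcomp Require Import ring lra zify.

(* The points [y] with [chi y = chi x] for all [chi] in a countable set of
   characters form a G_delta-set, and a filter-base with a countable member
   cannot tell them from [x]; hence the G_delta-closure of [H] lies in [l(H)].

   Conversely, let a G_delta-set [S] contain [x] and miss [H].  By Peter-Weyl
   for precompact groups, [S] contains every [y] on which countably many
   characters [D j] agree with [x], so no element of [H] agrees with [x] on all
   of them.  Then, given finitely many [h] in [H], some integer combination of
   the [D j] is close to 0 at each [h] but far from 0 at [x] (Comfort-Ross); the
   sets of such combinations form a filter-base converging to 0 on [H] but not
   at [x].

   Peter-Weyl is obtained by Bogolyubov's method: a group [(Z/N)^r] is mapped
   almost homomorphically to [P] through points almost killed by [N]; Fourier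
   analysis there yields boundedly many characters, those at which a bump
   function has a large Fourier coefficient, controlling a neighbourhood of 0
   and almost constant on a smaller one; Tychonoff's theorem then glues these
   finite approximations into continuous characters of [P]. *)

Set Implicit Arguments.
Unset Strict Implicit.
Unset Printing Implicit Defensive.

Import Order.TTheory GRing.Theory Num.Theory.
Import numFieldNormedType.Exports.

Local Open Scope classical_set_scope.
Local Open Scope ring_scope.
Local Open Scope quotient_scope.

(** * Trigonometry on the circle *)

Section CircleTrigo.
Variable R : realType.
Local Notation T := (circle R).
Implicit Types (x y t : R) (z w : T).

Definition toT (x : R) : T := \pi_T x.
(** The real part of [exp (2 pi i z)]. Closeness of [z] to 0 is measured throughout by [cosT z]
    being close to 1. *)
Definition cosT (z : T) : R := cos (trigo.pi *+ 2 * repr z).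
Definition sinT (z : T) : R := sin (trigo.pi *+ 2 * repr z).

Lemma toT_reprK z : toT (repr z) = z.
Proof. exact: reprK. Qed.

Lemma toTP x y : reflect (toT x = toT y) (x - y \is a Rint).
Proof. exact: circle_piP. Qed.

Lemma toTB x y : toT (x - y) = toT x - toT y.
Proof. exact: circle_piB. Qed.

Lemma toT0 : toT 0 = 0.
Proof. by rewrite -(subrr 0) toTB subrr. Qed.

Lemma toTD x y : toT (x + y) = toT x + toT y.
Proof. by rewrite -{1}(opprK y) toTB -sub0r toTB toT0 sub0r opprK. Qed.

Lemma toT_continuous : continuous toT.
Proof. exact: pi_continuous. Qed.

Lemma periodic_int (f : R -> R) a : periodic f a ->
  forall x (m : int), f (x + a *~ m) = f x.
Proof.
move=> fa x [n|n]; first exact: periodicn.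
by rewrite NegzE mulrNz -(periodicn fa n.+1 (x - _)) -pmulrn addrNK.
Qed.

Lemma repr_toT x : exists m : int, repr (toT x) = x + m%:~R.
Proof.
have /toTP/RintP[m xm] := toT_reprK (toT x).
by exists m; rewrite -xm addrC subrK.
Qed.

Lemma cosT_toT x : cosT (toT x) = cos (trigo.pi *+ 2 * x).
Proof.
rewrite /cosT; have [m ->] := repr_toT x.
by rewrite mulrDr mulrzr periodic_int//; exact: cosD2pi.
Qed.

Lemma sinT_toT x : sinT (toT x) = sin (trigo.pi *+ 2 * x).
Proof.
rewrite /sinT; have [m ->] := repr_toT x.
by rewrite mulrDr mulrzr periodic_int//; exact: sinD2pi.
Qed.

Lemma cosT0 : cosT 0 = 1.
Proof. by rewrite -toT0 cosT_toT mulr0 cos0. Qed.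

Lemma cosTD z w : cosT (z + w) = cosT z * cosT w - sinT z * sinT w.
Proof.
by rewrite -(toT_reprK z) -(toT_reprK w) -toTD !cosT_toT !sinT_toT mulrDr cosD.
Qed.

Lemma cosTB z w : cosT (z - w) = cosT z * cosT w + sinT z * sinT w.
Proof.
by rewrite -(toT_reprK z) -(toT_reprK w) -toTB !cosT_toT !sinT_toT mulrBr cosB.
Qed.

Lemma sinTB z w : sinT (z - w) = sinT z * cosT w - cosT z * sinT w.
Proof.
by rewrite -(toT_reprK z) -(toT_reprK w) -toTB !cosT_toT !sinT_toT mulrBr sinB.
Qed.

Lemma cosT_le1 z : cosT z <= 1.
Proof. exact: cos_le1. Qed.

Lemma cosT_geN1 z : -1 <= cosT z.
Proof. exact: cos_geN1. Qed.

Lemma cosT2DsinT2 z : cosT z ^+ 2 + sinT z ^+ 2 = 1.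
Proof. exact: cos2Dsin2. Qed.

Lemma toT_lift z : exists2 t, -2^-1 <= t <= 2^-1 & toT t = z.
Proof.
set r := repr z; set m := Num.floor (r + 2^-1).
exists (r - m%:~R).
  have := floor_itv (r + 2^-1); rewrite -/m intrD => /andP[m1 m2].
  by lra.
rewrite -(toT_reprK z); apply/toTP.
by rewrite addrAC subrr sub0r rpredN; apply/RintP; exists m.
Qed.

Lemma twopi_itv x : 0 <= x <= 2^-1 -> trigo.pi *+ 2 * x \in `[0, trigo.pi].
Proof.
have p0 := @pi_gt0 R.
by rewrite in_itv/= -mulr_natr => x0; apply/andP; split; nra.
Qed.

Lemma norm_lift_lt z (r : R) : 0 < r <= 2^-1 -> cos (trigo.pi *+ 2 * r) < cosT z ->
  exists2 t, `|t| < r & toT t = z.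
Proof.
move=> r0; have [t tb <-] := toT_lift z.
rewrite cosT_toT => rt; exists t => //.
move: rt; rewrite -[cos (_ * t)]cos_norm normrM ger0_norm; last first.
  by rewrite mulrn_wge0// pi_ge0.
have p0 := @pi_gt0 R.
have nt : 0 <= `|t| <= 2^-1 by rewrite normr_ge0 ler_norml.
have rb : 0 <= r <= 2^-1 by lra.
by rewrite ltr_cos ?twopi_itv// ltr_pM2l// pmulrn_lgt0.
Qed.

Lemma cosT_eq1 z : cosT z = 1 -> z = 0.
Proof.
have [t tb <-] := toT_lift z.
rewrite cosT_toT -cos_norm normrM ger0_norm; last first.
  by rewrite mulrn_wge0// pi_ge0.
have p0 := @pi_gt0 R.
have nt : 0 <= `|t| <= 2^-1 by rewrite normr_ge0 ler_norml.
rewrite -[in RHS]cos0 => /cos_inj H.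
suff -> : t = 0 by rewrite toT0.
apply/eqP; rewrite -normr_eq0; apply/eqP.
have /eqP : trigo.pi *+ 2 * `|t| = 0.
  by apply: H; rewrite ?twopi_itv// in_itv/= lexx pi_ge0.
by rewrite mulf_eq0 mulrn_eq0/= gt_eqF//= => /eqP.
Qed.

Lemma cosT_continuous : continuous cosT.
Proof.
apply/quotient_continuous.
rewrite [X in continuous X](_ : _ = cos \o *%R (trigo.pi *+ 2)).
  move=> x; apply: continuous_comp; first exact: mulrl_continuous.
  exact: continuous_cos.
by apply/funext => x; exact: cosT_toT.
Qed.

Lemma nbhs_circle0 (U : set T) : nbhs (0 : T) U ->
  exists2 e : R, 0 < e & forall z, 1 - e < cosT z -> U z.
Proof.
move=> U0; have : nbhs (0 : R) (toT @^-1` U).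
  have := @toT_continuous 0 U; rewrite toT0; exact.
move=> /nbhs_ballP[r /= r0 rU].
(* The cap at 1/2 keeps the angle [2 pi s] in [[0, pi]], where cosine is decreasing. *)
pose s := Num.min r 2^-1.
have s0 : 0 < s <= 2^-1 by rewrite lt_min r0 ge_min lexx orbT invr_gt0 ltr0n.
have p0 := @pi_gt0 R.
exists (1 - cos (trigo.pi *+ 2 * s)).
  have s0' : 0 <= s <= 2^-1 by lra.
  rewrite subr_gt0 -[X in _ < X]cos0 ltr_cos ?twopi_itv//.
    have s_gt0 : 0 < s by case/andP: s0.
    by rewrite mulr_gt0// pmulrn_lgt0.
  by rewrite in_itv/= lexx pi_ge0.
move=> z; rewrite subKr => /(norm_lift_lt s0)[t ts <-].
apply: rU; rewrite /ball/= sub0r normrN (lt_le_trans ts)//.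
by rewrite ge_min lexx.
Qed.

Lemma open_cosT_gt (c : R) : open [set z | c < cosT z].
Proof.
by move/continuousP: cosT_continuous => /(_ _ (@open_gt R c)); exact.
Qed.

Lemma circle_compact : compact [set: T].
Proof.
have -> : [set: T] = toT @` `[-2^-1, 2^-1].
  apply/seteqP; split=> // z _.
  have [t tb tz] := toT_lift z.
  by exists t => //; rewrite /= in_itv.
apply: continuous_compact; last exact: segment_compact.
exact/continuous_subspaceT/toT_continuous.
Qed.

Lemma cosT_mul2 z : 1 - cosT (z *+ 2) = 2 * (1 - cosT z) * (1 + cosT z).
Proof.
rewrite mulr2n cosTD.
by have := cosT2DsinT2 z; nra.
Qed.

(** As long as [cosT z >= 1/2], doubling [z] multiplies [1 - cosT z] by [2 (1 + cosT z) >= 3], and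
    after [n] doublings the result is still at most 1. *)
Lemma cosT_doubling n z : (forall j, (j <= n)%N -> 2^-1 <= cosT (z *+ 2 ^ j)) ->
  1 - cosT z <= 3^-1 ^+ n.
Proof.
elim: n z => [|n IH] z zn.
  by have := zn 0%N isT; rewrite expr0 expn0 mulr1n; lra.
have := IH (z *+ 2); rewrite cosT_mul2 => H.
have {}H : 2 * (1 - cosT z) * (1 + cosT z) <= 3^-1 ^+ n.
  by apply: H => j jn; rewrite -mulrnA -expnS; exact: zn.
have z2 : 2^-1 <= cosT z by have := zn 0%N isT; rewrite expn0 mulr1n.
have := cosT_le1 z; rewrite exprS; nra.
Qed.

Lemma cosT_no_small_subgroup z : (forall j, 2^-1 <= cosT (z *+ 2 ^ j)) -> z = 0.
Proof.
move=> zj; apply: cosT_eq1; apply/eqP; rewrite eq_le cosT_le1/=.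
apply/ler_addgt0Pr => e e0.
have /cvgr0Pnorm_lt/(_ e e0)[n _ /(_ n (leqnn n))] :
    (3^-1 : R) ^+ n @[n --> \oo] --> (0 : R).
  by apply: cvg_expr; rewrite ger0_norm; lra.
rewrite ger0_norm ?exprn_ge0// => ne.
have := @cosT_doubling n z (fun j _ => zj j); lra.
Qed.

(** Cuts the circle into short arcs; total boundedness in the form that pigeonhole arguments use. *)
Lemma circle_coloring (e : R) : 0 < e ->
  exists M, exists col : T -> 'I_M,
    forall z w, col z = col w -> 1 - e < cosT (z - w).
Proof.
move=> e0.
have : nbhs (0 : R) (toT @^-1` [set z | 1 - e < cosT z]).
  have := @toT_continuous 0 [set z | 1 - e < cosT z]; apply.
  apply: open_nbhs_nbhs; split; first exact: open_cosT_gt.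
  rewrite /= toT0 cosT0. lra.
move=> /nbhs_ballP[r /= r0 rU].
pose M := (Num.truncn r^-1).+1.
have M0 : 0 < M%:R :> R by rewrite ltr0n.
have rM : M%:R^-1 < r.
  rewrite -[X in _ < X]invrK ltf_pV2 ?posrE ?invr_gt0//.
  exact: truncnS_gt.
pose l z := xget 0 [set t | -2^-1 <= t <= 2^-1 /\ toT t = z].
have lP z : -2^-1 <= l z <= 2^-1 /\ toT (l z) = z.
  by have [t tb tz] := toT_lift z; rewrite /l; case: xgetP => // /(_ t) [].
(* [M.+1] colours, since a lift equal to 1/2 has integer part [M]. *)
exists M.+1, (fun z => inord (Num.truncn ((l z + 2^-1) * M%:R))) => z w.
have ge0 u : 0 <= (l u + 2^-1) * M%:R.
  by have [/andP[l1 l2] _] := lP u; rewrite mulr_ge0//; lra.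
have bd u : (Num.truncn ((l u + 2^-1) * M%:R) < M.+1)%N.
  have [/andP[l1 l2] _] := lP u.
  have := truncn_le ((l u + 2^-1) * M%:R).
  rewrite ge0 ltnS -(ler_nat R) => /le_trans; apply.
  by rewrite ger_pMl//; lra.
move=> /(congr1 val); rewrite /= !inordK// => zw.
have := truncn_itv (ge0 z); have := truncn_itv (ge0 w); rewrite zw.
move: (Num.truncn _) => k /andP[w1 w2] /andP[z1 z2].
have [_ <-] := lP z; have [_ <-] := lP w; rewrite -toTB.
apply: rU; rewrite /ball/= sub0r normrN (lt_trans _ rM)//.
rewrite -div1r ltr_pdivlMr// -[X in _ * X]ger0_norm ?ltW// -normrM ltr_norml.
move: w1 w2 z1 z2; rewrite -(natr1 k); nra.
Qed.

End CircleTrigo.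

Arguments cosT {R} z.
Arguments sinT {R} z.

(** * Neighbourhoods of 0 and continuity in topological abelian groups *)

Section TopologicalZmod.
Variable G : topologicalZmodType.
Implicit Types (x y : G) (U : set G).

Lemma nbhs0_subr x U : nbhs 0 U -> nbhs x [set y | U (y - x)].
Proof.
move=> U0.
have /= c : {for x, continuous (fun y => y - x)}.
  apply: (@continuous_comp _ _ _ (fun y => (y, x)) (fun p : G * G => p.1 - p.2)).
    by apply: cvg_pair => /=; [exact: cvg_id|exact: cvg_cst].
  exact: sub_continuous.
by apply: c; rewrite subrr.
Qed.

Lemma nbhs0_addr x U : nbhs x U -> nbhs 0 [set y | U (x + y)].
Proof.
move=> Ux.
have /= c : {for 0, continuous (fun y => x + y)}.
  apply: (@continuous_comp _ _ _ (fun y => (x, y)) (fun p : G * G => p.1 + p.2)).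
    by apply: cvg_pair => /=; [exact: cvg_cst|exact: cvg_id].
  exact: add_continuous.
by apply: c; rewrite addr0.
Qed.

Lemma nbhs0_sub U : nbhs 0 U ->
  exists2 V, nbhs 0 V & forall x y, V x -> V y -> U (x - y).
Proof.
move=> U0; have := @sub_continuous G (0, 0) U; rewrite /= subr0 => /(_ U0).
case=> -[A B] /= [A0 B0] AB; exists (A `&` B); first exact: filterI.
by move=> x y [Ax _] [_ By]; exact: (AB (x, y)).
Qed.

(** Serves to bound any expression with at most [n] terms in one go, by writing it as a sum over an
    explicit list; the symmetry of [V] allows minus signs. *)
Lemma nbhs0_sum U n : nbhs 0 U -> exists V, [/\ nbhs 0 V,
  (forall x, V x -> V (- x)) & forall s : seq G, (size s <= n)%N ->
  (forall x, x \in s -> V x) -> U (\sum_(x <- s) x)].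
Proof.
elim: n U => [|n IH] U U0.
  exists setT; split; [exact: filterT|by []|move=> [|//] _ _].
  by rewrite big_nil; exact: nbhs_singleton.
have [V V0 VU] := nbhs0_sub U0.
have [W [W0 Ws WV]] := IH V V0.
have NV0 : nbhs 0 [set x | V (- x)].
  by apply: (@opp_continuous G 0); rewrite oppr0.
exists (W `&` (V `&` [set x | V (- x)])); split.
- by apply: filterI => //; exact: filterI.
- by move=> x [Wx [Vx /= Vnx]]; split; [exact: Ws|split => //=; rewrite opprK].
move=> [|x s] sn sV; first by rewrite big_nil; exact: nbhs_singleton.
rewrite big_cons addrC -[x]opprK; apply: VU.
  by apply: WV => // y ys; have [] := sV y; rewrite ?inE ?ys ?orbT.
by have [] := sV x; rewrite ?inE ?eqxx// => _ [].
Qed.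

End TopologicalZmod.

Section ContinuousZmod.
Variables (X : topologicalType) (G : topologicalZmodType).
Implicit Types f g : X -> G.

Lemma continuous_addr f g : continuous f -> continuous g ->
  continuous (fun x => f x + g x).
Proof.
move=> cf cg x.
apply: (@continuous_comp _ _ _ (fun x => (f x, g x)) (fun p : G * G => p.1 + p.2)).
  by apply: cvg_pair => /=; [exact: cf|exact: cg].
exact: add_continuous.
Qed.

Lemma continuous_subr f g : continuous f -> continuous g ->
  continuous (fun x => f x - g x).
Proof.
move=> cf cg x.
apply: (@continuous_comp _ _ _ (fun x => (f x, g x)) (fun p : G * G => p.1 - p.2)).
  by apply: cvg_pair => /=; [exact: cf|exact: cg].
exact: sub_continuous.
Qed.

Lemma continuous_mulrn f n : continuous f -> continuous (fun x => f x *+ n).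
Proof.
move=> cf; elim: n => [|n IH]; first by move=> x; exact: cvg_cst.
by under eq_fun do rewrite mulrS; exact: continuous_addr.
Qed.

Lemma continuous_mulrz f (m : int) : continuous f -> continuous (fun x => f x *~ m).
Proof.
move=> cf; case: m => n; first exact: continuous_mulrn.
have -> : (fun x => f x *~ Negz n) = (fun x => 0 - f x *+ n.+1).
  by apply/funext => x; rewrite sub0r.
apply: continuous_subr; last exact: continuous_mulrn.
by move=> x; exact: cvg_cst.
Qed.

Lemma continuous_sumr (I : Type) (r : seq I) (F : I -> X -> G) :
  (forall i, continuous (F i)) -> continuous (fun x => \sum_(i <- r) F i x).
Proof.
move=> cF; elim: r => [|i r IH].
  by under eq_fun do rewrite big_nil; move=> x; exact: cvg_cst.
by under eq_fun do rewrite big_cons; exact: continuous_addr.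
Qed.

End ContinuousZmod.

Lemma precompact_cover (P : topologicalZmodType) (U : set P) :
  precompact_group P -> nbhs 0 U ->
  exists ys : seq P, forall p, exists2 y, y \in ys & U (p - y).
Proof.
move=> hP /hP[Y /finite_seqP[ys ->] Yc]; exists ys => p.
have : [set: P] p by [].
by rewrite Yc => -[y /= yys [u Eu <-]]; exists y => //; rewrite addrAC subrr add0r.
Qed.

(* This holds because the circle has no small subgroups. *)
Lemma additive_circle_continuous (R : realType) (G : topologicalZmodType)
    (f : {additive G -> circle R}) (W : set G) :
  nbhs 0 W -> (forall x, W x -> 2^-1 <= cosT (f x)) -> continuous f.
Proof.
move=> W0 Wf x U Ufx.
have [e e0 eU] := nbhs_circle0 (nbhs0_addr Ufx).
have /cvgr0Pnorm_lt/(_ e e0)[n _ /(_ n (leqnn n))] :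
    (3^-1 : R) ^+ n @[n --> \oo] --> (0 : R).
  by apply: cvg_expr; rewrite ger0_norm; lra.
rewrite ger0_norm ?exprn_ge0// => ne.
(* For [y - x] in [V], the multiples by [2 ^ j] with [j <= n] all stay in [W], so [cosT_doubling]
   applies to [f (y - x)]. *)
have [V [V0 _ VW]] := nbhs0_sum (2 ^ n) W0.
apply: filterS (nbhs0_subr x V0) => y /= Vy.
have /= := eU (f y - f x); rewrite [f x + _]addrC subrK; apply.
rewrite -raddfB.
suff : 1 - cosT (f (y - x)) <= 3^-1 ^+ n by lra.
apply: cosT_doubling => j jn; rewrite -raddfMn; apply: Wf.
have -> : (y - x) *+ 2 ^ j = \sum_(z <- nseq (2 ^ j) (y - x)) z.
  by rewrite big_nseq iter_addr_0.
apply: VW; first by rewrite size_nseq leq_exp2l.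
by move=> z; rewrite mem_nseq => /andP[_ /eqP->].
Qed.

(** * Almost invariant means *)

Section Means.
Variables (R : realType) (L : zmodType).
Implicit Types (f g : L -> R) (M : (L -> R) -> R) (a b : L) (l : seq L).

Record is_mean M : Prop := IsMean {
  meanD : forall f g, M (fun b => f b + g b) = M f + M g;
  meanZ : forall c f, M (fun b => c * f b) = c * M f;
  mean_le : forall f g, (forall b, f b <= g b) -> M f <= M g;
  mean1 : M (fun=> 1) = 1 }.

Definition almost_invariant (d : R) M a := forall f,
  (forall b, `|f b| <= 1) -> `|M (fun b => f (b + a)) - M f| <= d.

Lemma mean_cst M c : is_mean M -> M (fun=> c) = c.
Proof.
move=> mM; rewrite -[RHS]mulr1 -(mean1 mM) -(meanZ mM).
by congr M; apply/funext => b; rewrite mulr1.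
Qed.

Lemma mean_sum M (I : Type) (r : seq I) (F : I -> L -> R) : is_mean M ->
  M (fun b => \sum_(i <- r) F i b) = \sum_(i <- r) M (F i).
Proof.
move=> mM; elim: r => [|i r IH].
  by rewrite big_nil -[RHS](mean_cst 0 mM); congr M; apply/funext => b; rewrite big_nil.
rewrite big_cons -IH -(meanD mM).
by congr M; apply/funext => b; rewrite big_cons.
Qed.

Lemma mean_norm M f : is_mean M -> (forall b, `|f b| <= 1) -> `|M f| <= 1.
Proof.
move=> mM f1.
have h b : -1 <= f b /\ f b <= 1 by apply/andP; rewrite -ler_norml.
have := mean_le mM (fun b => (h b).1); have := mean_le mM (fun b => (h b).2).
by rewrite !mean_cst// ler_norml => -> ->.
Qed.

(** Translations are added one at a time. Averaging [M] over the first [N] multiples of [a] makes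
    the effect of [a] telescope to two terms, of size at most [2 / N]; invariance under the earlier
    translations survives because [L] is commutative. *)
Lemma almost_invariant_mean l (d : R) : 0 < d ->
  exists M, is_mean M /\ forall a, a \in l -> almost_invariant d M a.
Proof.
move=> d0; elim: l => [|a l [M [mM Ml]]].
  by exists (fun f => f 0); split.
pose N := (Num.truncn (2 / d)).+1.
have N0 : 0 < N%:R :> R by rewrite ltr0n.
have N2 : 2 / N%:R <= d.
  by rewrite ler_pdivrMr// mulrC -ler_pdivrMr// ltW// truncnS_gt.
exists (fun f => N%:R^-1 * \sum_(0 <= n < N) M (fun b => f (b + a *+ n))).
split; first split.
- by move=> f g; rewrite -mulrDr -big_split/=; under eq_bigr do rewrite (meanD mM).
- move=> c f; rewrite mulrCA; congr (_ * _); rewrite mulr_sumr.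
  by under eq_bigr do rewrite (meanZ mM).
- move=> f g fg; rewrite ler_pM2l ?invr_gt0// ler_sum// => n _.
  exact: (mean_le mM).
- under eq_bigr do rewrite (mean1 mM).
  by rewrite sumr_const_nat subn0 mulVf// gt_eqF.
move=> a'; rewrite inE => /orP[/eqP ->{a'}|al] f f1.
  rewrite -mulrBr.
  have -> : \sum_(0 <= n < N) M (fun b => f (b + a *+ n + a)) =
      \sum_(0 <= n < N) M (fun b => f (b + a *+ n.+1)).
    apply: eq_bigr => n _; congr M; apply/funext => b.
    by rewrite mulrSr addrA.
  rewrite -sumrB telescope_sumr// normrM ger0_norm ?invr_ge0//.
  apply: le_trans _ N2; rewrite mulrC ler_pM2r ?invr_gt0//.
  have h n : `|M (fun b => f (b + a *+ n))| <= 1 by exact: mean_norm.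
  by apply: (le_trans (ler_normB _ _)); have := h N; have := h 0%N; lra.
rewrite -mulrBr -sumrB normrM ger0_norm ?invr_ge0//.
rewrite ler_pdivrMl// (le_trans (ler_norm_sum _ _ _))//.
rewrite -[N in N%:R]subn0 mulr_natl -sumr_const_nat ler_sum// => n _.
have := Ml a' al (fun b => f (b + a *+ n)) (fun b => f1 _).
suff -> : (fun b => f (b + a *+ n + a')) = (fun b => f (b + a' + a *+ n)) by [].
by apply/funext => b; rewrite addrAC.
Qed.

(** A limit along this filter plays the part of the value of an invariant mean. *)
Definition mean_filter : set_system ((L -> R) -> R) :=
  filter_from [set p : seq L * R | 0 < p.2]
    (fun p => [set M | is_mean M /\ forall a, a \in p.1 -> almost_invariant p.2 M a]).

Global Instance mean_filter_proper : ProperFilter mean_filter.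
Proof.
apply: filter_from_proper; last first.
  by move=> [l d] /= d0; have [M ?] := almost_invariant_mean l d0; exists M.
apply: filter_from_filter; first by exists ([::], 1) => /=.
move=> [l d] [l' d'] /= d0 d0'; exists (l ++ l', Num.min d d').
  by rewrite /= lt_min d0.
move=> M /= [mM Ml]; split; split=> // a al f f1.
  have := Ml a; rewrite mem_cat al => /(_ isT f f1) /le_trans; apply.
  by rewrite ge_min lexx.
have := Ml a; rewrite mem_cat al orbT => /(_ isT f f1) /le_trans; apply.
by rewrite ge_min lexx orbT.
Qed.

Lemma mean_filter_mean : \forall M \near mean_filter, is_mean M.
Proof. by exists ([::], 1) => //= M []. Qed.

Lemma mean_filter_invariant l (d : R) : 0 < d ->
  \forall M \near mean_filter, forall a, a \in l -> almost_invariant d M a.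
Proof. by move=> d0; exists (l, d) => //= M []. Qed.

(** A nontrivial character has mean 0: the translates of [cosT \o psi] by [a] and [- a] add up to
    [2 * cosT (psi a)] times it, while almost invariance makes the mean of their sum nearly twice
    its mean. *)
Lemma mean_cos_cvg0 (psi : {additive L -> circle R}) a : psi a <> 0 ->
  M (cosT \o psi) @[M --> mean_filter] --> 0.
Proof.
move=> pa; have c1 : 0 < 1 - cosT (psi a).
  by rewrite subr_gt0 lt_neqAle cosT_le1 andbT; apply/eqP => /cosT_eq1.
apply/cvgr0Pnorm_lt => e e0.
have d0 : 0 < e * (1 - cosT (psi a)) / 2 by rewrite divr_gt0// mulr_gt0.
have := mean_filter_mean.
apply: filterS2 (mean_filter_invariant [:: a; - a] d0) => M Ma mM.
have ok b : `|(cosT \o psi) b| <= 1 by rewrite ler_norml cosT_geN1 cosT_le1.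
have := Ma a; rewrite !inE eqxx => /(_ isT _ ok).
have := Ma (- a); rewrite !inE eqxx orbT => /(_ isT _ ok).
have : M (fun b => (cosT \o psi) (b + a)) + M (fun b => (cosT \o psi) (b - a)) =
    2 * cosT (psi a) * M (cosT \o psi).
  rewrite -(meanD mM) -(meanZ mM); congr M; apply/funext => b /=.
  by rewrite raddfB raddfD cosTB cosTD; ring.
set u := M (fun b => _ (b + a)); set v := M (fun b => _ (b - a)); set w := M _.
move=> uvw; rewrite !ler_norml => /andP[v1 v2] /andP[u1 u2].
by rewrite ltr_norml; apply/andP; split; nra.
Qed.

End Means.

(** * Finitely generated groups of characters *)

Section CharactersNearFinitelyMany.
Variables (R : realType) (L : zmodType) (n : nat).
Variables (h : 'I_n -> {additive L -> circle R}) (x : {additive L -> circle R}).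

(** A product of factors [cos ^ 2] of the half angle, peaked where all [h i] are near 0. Indices may
    repeat in [r], so powers of a kernel are again kernels. *)
Definition cos_kernel (r : seq 'I_n) (b : L) : R :=
  \prod_(i <- r) ((1 + cosT (h i b)) / 2).

Lemma cos_kernel_ge0 r b : 0 <= cos_kernel r b.
Proof.
by apply: prodr_ge0 => i _; have := cosT_geN1 (h i b); lra.
Qed.

Lemma cos_kernel_le1 r b : cos_kernel r b <= 1.
Proof.
apply: prodr_ile1 => i _.
by have := cosT_geN1 (h i b); have := cosT_le1 (h i b); lra.
Qed.

Lemma cos_kernel_nseq m r b :
  cos_kernel (flatten (nseq m r)) b = cos_kernel r b ^+ m.
Proof.
elim: m => [|m IH]; first by rewrite /cos_kernel big_nil.
by rewrite exprS -IH /cos_kernel big_cat.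
Qed.

Lemma cos_kernel_enum_le (e : R) b i : cosT (h i b) <= 1 - e ->
  cos_kernel (enum 'I_n) b <= 1 - e / 2.
Proof.
move=> hi; rewrite /cos_kernel big_enum (bigD1 i)//=.
have p0 : 0 <= \prod_(j < n | j != i) ((1 + cosT (h j b)) / 2).
  by apply: prodr_ge0 => j _; have := cosT_geN1 (h j b); lra.
have p1 : \prod_(j < n | j != i) ((1 + cosT (h j b)) / 2) <= 1.
  apply: prodr_ile1 => j _.
  by have := cosT_geN1 (h j b); have := cosT_le1 (h j b); lra.
by have := cosT_geN1 (h i b); nra.
Qed.

Lemma cos_kernel_enum_ge (e : R) b : 0 <= e <= 1 ->
  (forall i, 1 - e <= cosT (h i b)) ->
  1 - n%:R * e <= cos_kernel (enum 'I_n) b.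
Proof.
move=> e01 he; rewrite -[n in n%:R](size_enum_ord n) /cos_kernel.
elim: (enum 'I_n) => [|i r IH]; first by rewrite big_nil mul0r subr0.
rewrite big_cons /= -natr1; have := he i; have := cos_kernel_ge0 r b.
have := cosT_le1 (h i b); have := cos_kernel_le1 r b; rewrite /cos_kernel.
move: IH; set p := \prod_(j <- _) _; have : 0 <= (size r)%:R :> R by [].
by move: (size r)%:R (cosT _) p => s c p; nra.
Qed.

Hypothesis xNspan : forall k : 'I_n -> int,
  exists a, x a <> \sum_i h i a *~ k i.

Definition twist (k : 'I_n -> int) (b : L) : circle R :=
  x b + \sum_i h i b *~ k i.

Fact twist_is_additive k : zmod_morphism (twist k).
Proof.
move=> a b; rewrite /twist raddfB opprD addrACA; congr (_ + _).
by rewrite -sumrB; apply: eq_bigr => i _; rewrite raddfB mulrzBl.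
Qed.

HB.instance Definition _ k :=
  GRing.isZmodMorphism.Build L (circle R) (twist k) (twist_is_additive k).

Lemma twistD k i (s : int) b :
  twist (fun j => k j + (j == i)%:R * s) b = twist k b + h i b *~ s.
Proof.
rewrite /twist -addrA; congr (_ + _).
under eq_bigr do rewrite mulrzDr.
rewrite big_split/=; congr (_ + _).
rewrite (bigD1 i)//= eqxx mul1r big1 ?addr0// => j /negPf ->.
by rewrite mul0r.
Qed.

(** Multiplying by [(1 + cosT (h i b)) / 2] turns the cosine of a twist into a combination of
    cosines of three twists, with [k i] shifted by 0, 1 and -1; hence the induction over all [k]. No
    twist is trivial, as [x] is not in the span of the [h i]. *)
Lemma mean_kernel_twist_cvg0 r k :
  M (fun b => cos_kernel r b * cosT (twist k b)) @[M --> @mean_filter R L] --> 0.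
Proof.
elim: r k => [|i r IH] k.
  have [a ya] := xNspan (fun i => - k i).
  have yk : twist k a <> 0.
    apply: contra_not ya => /eqP; rewrite /twist addr_eq0 => /eqP ->.
    by rewrite -sumrN; apply: eq_bigr => i _; rewrite mulrNz.
  have := mean_cos_cvg0 yk; apply: cvg_trans; apply: near_eq_cvg; near=> M.
  by congr M; apply/funext => b /=; rewrite /cos_kernel big_nil mul1r.
have c (a : R) k' : a * M (fun b => cos_kernel r b * cosT (twist k' b))
    @[M --> @mean_filter R L] --> 0.
  by rewrite -(mulr0 a); exact: (cvgMr (IH k')).
have := cvgD (c 2^-1 k) (cvgD (c 4^-1 (fun j => k j + (j == i)%:R * 1))
  (c 4^-1 (fun j => k j + (j == i)%:R * -1))).
move=> /(_ _ _); rewrite !addr0 => H; apply: cvg_trans H; apply: near_eq_cvg.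
apply: filterS (mean_filter_mean R L) => M mM; rewrite !fctE.
rewrite -!(meanZ mM) -!(meanD mM); congr M; apply/funext => b.
rewrite !twistD mulr1z mulrN1z cosTD cosTB /cos_kernel big_cons; field.
Unshelve. all: by end_near.
Qed.

(* If [x] stays close to 0 wherever all the [h i] do, then the mean of
   [f * cos x], where [f] is a high power of [prod_i (1 + cos (h i)) / 2], is
   both zero, as [f * cos x] is a combination of nontrivial characters, and at
   least about half the mean of [f], which by pigeonhole decays no faster
   than [p ^+ m], against [q ^+ m] for the contribution of the other points. *)
Lemma character_not_near_span (e : R) : 0 < e ->
  exists a, (forall i, 1 - e < cosT (h i a)) /\ cosT (x a) <= 2^-1.
Proof.
wlog e1 : e / e <= 1.
  move=> W e0; have := W (Num.min e 1); rewrite ge_min lexx orbT lt_min e0 ltr01.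
  move=> /(_ isT isT)[a [ha xa]]; exists a; split=> // i.
  by apply: le_lt_trans (ha i); rewrite lerD2l lerN2 ge_min lexx.
move=> e0; apply: contrapT => noa.
have good a : (forall i, 1 - e < cosT (h i a)) -> 2^-1 < cosT (x a).
  by move=> ha; rewrite ltNge; apply/negP => xa; apply: noa; exists a.
(* [q] bounds the kernel wherever some [h i] is not close to 0; [p], strictly between [q] and 1,
   will bound it from below near 0. *)
pose q : R := 1 - e / 2; pose p : R := (1 + q) / 2.
have q0 : 2^-1 <= q by rewrite /q; lra.
have qp : q < p by rewrite /p /q; lra.
have p1 : p < 1 by rewrite /p /q; lra.
(* Small enough that the kernel is at least [1 - n * eta >= p] at a difference of two points of the
   same colour. *)
pose eta := (1 - p) / n.+1%:R.
have n0 : 0 < n.+1%:R :> R by rewrite ltr0n.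
have eta0 : 0 < eta by rewrite divr_gt0// subr_gt0.
have eta1 : n%:R * eta <= 1 - p.
  rewrite /eta mulrCA ger_pMr ?subr_gt0// ler_pdivrMr// mul1r ler_nat//.
have eta2 : eta <= 1.
  rewrite ler_pdivrMr// mul1r; apply: (@le_trans _ _ 1); first by lra.
  by rewrite ler1n.
have [N [col colP]] := circle_coloring eta0.
pose c a : {ffun 'I_n -> 'I_N} := [ffun i => col (h i a)].
pose rep (u : {ffun 'I_n -> 'I_N}) : L := xget 0 [set a | c a = u].
have crep a : c (rep (c a)) = c a.
  by rewrite /rep; case: xgetP => [b _ /= -> //|/(_ a) /= []].
pose K := #|{ffun 'I_n -> 'I_N}|.
have K0 : 0 < K%:R :> R.
  by rewrite ltr0n; apply/card_gt0P; exists (c 0).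
pose F m b := cos_kernel (enum 'I_n) b ^+ m.
(* At every [a] one of the [K] translates is large: the one by the representative of the colour
   class of [a]. *)
have Fp m a : p ^+ m <= \sum_u F m (a - rep u).
  rewrite (bigD1 (c a))//= -[X in X <= _]addr0 lerD//; last first.
    by apply: sumr_ge0 => u _; rewrite exprn_ge0// cos_kernel_ge0.
  rewrite lerXn2r ?nnegrE ?cos_kernel_ge0//; first by lra.
  apply: le_trans (@cos_kernel_enum_ge eta _ _ _); first by lra.
    by rewrite eta2 ltW.
  move=> i; rewrite raddfB ltW//; apply: colP.
  by have /ffunP/(_ i) := crep a; rewrite !ffunE => ->.
have [m mP] : exists m, 4 * K%:R * q ^+ m < p ^+ m.
  have p0 : 0 < p by lra.
  have : (q / p) ^+ m @[m --> \oo] --> 0.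
    apply: cvg_expr; rewrite ger0_norm; last by rewrite divr_ge0//; lra.
    by rewrite ltr_pdivrMr// mul1r.
  have K4 : 0 < (4 * K%:R)^-1 :> R by rewrite invr_gt0 mulr_gt0.
  move=> /cvgr0Pnorm_lt/(_ _ K4)[m _ /(_ m (leqnn m))] H; exists m.
  move: H; rewrite ger0_norm; last by rewrite exprn_ge0// divr_ge0//; lra.
  rewrite expr_div_n ltr_pdivrMr ?exprn_gt0// mulrC ltr_pdivlMr ?mulr_gt0//.
  by rewrite mulrC.
pose d := p ^+ m / (16 * K%:R).
have pm : 0 < p ^+ m by rewrite exprn_gt0//; lra.
have d0 : 0 < d by rewrite divr_gt0// mulr_gt0.
have := mean_kernel_twist_cvg0 (flatten (nseq m (enum 'I_n))) (fun=> 0).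
move=> /cvgr0Pnorm_lt/(_ _ d0) Mx.
have Mi := mean_filter_invariant (codom (fun u => - rep u)) d0.
have [M [[mM Mx'] Mi']] := filter_ex (filterI (filterI (mean_filter_mean R L) Mx) Mi).
move: Mx' => {Mx Mi} /=.
have -> : (fun b => cos_kernel (flatten (nseq m (enum 'I_n))) b *
    cosT (twist (fun=> 0) b)) = (fun b => F m b * cosT (x b)).
  apply/funext => b; rewrite cos_kernel_nseq; congr (_ * cosT _).
  by rewrite /twist big1 ?addr0// => i _; rewrite mulr0z.
move=> Mx.
have F01 b : 0 <= F m b <= 1.
  by rewrite exprn_ge0 ?cos_kernel_ge0// exprn_ile1 ?cos_kernel_ge0 ?cos_kernel_le1.
have q_ge0 : 0 <= q by lra.
have qm : 0 <= q ^+ m by rewrite exprn_ge0.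
(* Where all [h i] are near 0, the integrand is at least [F m / 2]; elsewhere [F m <= q ^+ m], and
   the integrand is at least [- F m]. *)
have lo : 2^-1 * M (F m) + - (3 / 2 * q ^+ m) <= M (fun b => F m b * cosT (x b)).
  rewrite -[X in _ + X](mean_cst _ mM) -(meanZ mM) -(meanD mM).
  apply: (mean_le mM) => b; have /andP[F0 F1] := F01 b.
  have [hb|] := pselect (forall i, 1 - e < cosT (h i b)).
    by have := good b hb; nra.
  move=> /existsNP[i /negP]; rewrite -leNgt => hi.
  have : F m b <= q ^+ m.
    have := cos_kernel_enum_le hi.
    by apply: lerXn2r; rewrite nnegrE ?cos_kernel_ge0.
  by have := cosT_geN1 (x b); nra.
have up : p ^+ m <= K%:R * (M (F m) + d).
  rewrite -{1}(mean_cst (p ^+ m) mM).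
  apply: (@le_trans _ _ (M (fun a => \sum_u F m (a - rep u)))).
    exact: (mean_le mM).
  rewrite (mean_sum _ _ mM) mulr_natl -sumr_const ler_sum// => u _.
  have := Mi' (- rep u) (codom_f _ u) (F m).
  have F1 b : `|F m b| <= 1 by have /andP[? ?] := F01 b; rewrite ger0_norm.
  by move=> /(_ F1); rewrite ler_norml => /andP[_]; lra.
have dE : K%:R * d = p ^+ m / 16.
  by rewrite /d; field; rewrite gt_eqF.
move: Mx; rewrite ltr_norml => /andP[_ Mx].
(* With [up] this gives [p ^+ m <= K * (3 * d + 3 * q ^+ m)], which is less than [3/16 + 3/4] of
   [p ^+ m]: a contradiction. *)
have : M (F m) <= 2 * d + 3 * q ^+ m by lra.
by nra.
Qed.

End CharactersNearFinitelyMany.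

(** * Bogolyubov's argument on a finite group *)

Section FiniteFourier.
Variables (R : realType) (A : finZmodType) (X : finType).
(** The family [xi] stands for the dual group of [A], with [x0] the trivial character; the
    cardinality and orthogonality hypotheses yield Parseval's identity. *)
Variables (xi : X -> {additive A -> circle R}) (x0 : X).
Hypothesis xi0 : forall a, xi x0 a = 0.
Hypothesis card_X : #|X| = #|A|.
Hypothesis xi_orth : forall a, a != 0 -> \sum_x cosT (xi x a) = 0 :> R.
Variable F : A -> R.
Implicit Types (a b c d m : A) (x : X) (t : circle R).

(** The squared modulus of the Fourier coefficient of [F] at [xi x]. *)
Definition power x : R :=
  (\sum_a F a * cosT (xi x a)) ^+ 2 + (\sum_a F a * sinT (xi x a)) ^+ 2.

Lemma power_ge0 x : 0 <= power x.
Proof. by rewrite addr_ge0// sqr_ge0. Qed.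

(** Expands the coefficient times its conjugate. The phase [t] lets the identity be applied twice,
    as needed for the square of [power]. *)
Lemma power_cos x t :
  \sum_a \sum_b F a * F b * cosT (xi x (a - b) + t) = power x * cosT t.
Proof.
have E (f g : circle R -> R) : \sum_a \sum_b F a * F b * (f (xi x a) * g (xi x b)) =
    (\sum_a F a * f (xi x a)) * (\sum_b F b * g (xi x b)).
  rewrite mulr_suml; apply: eq_bigr => a _; rewrite mulr_sumr.
  by apply: eq_bigr => b _; rewrite mulrACA.
under eq_bigr => a _.
  under eq_bigr => b _.
    rewrite raddfB cosTD cosTB sinTB.
    rewrite (_ : F a * F b * _ =
      cosT t * (F a * F b * (cosT (xi x a) * cosT (xi x b))) +
      cosT t * (F a * F b * (sinT (xi x a) * sinT (xi x b))) +
      (- sinT t * (F a * F b * (sinT (xi x a) * cosT (xi x b))) +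
      sinT t * (F a * F b * (cosT (xi x a) * sinT (xi x b))))); last by ring.
    over.
  rewrite !big_split/= -!mulr_sumr; over.
rewrite !big_split/= -!mulr_sumr !E /power; ring.
Qed.

Lemma sum_cosE a : \sum_x cosT (xi x a) = (a == 0)%:R * #|A|%:R :> R.
Proof.
have [->|/xi_orth ->] := eqVneq a 0; last by rewrite mul0r.
under eq_bigr do rewrite raddf0 cosT0.
by rewrite sumr_const card_X mul1r.
Qed.

Lemma sum_power : \sum_x power x = #|A|%:R * \sum_a F a ^+ 2.
Proof.
under eq_bigr => x _.
  rewrite -[power x]mulr1 -(@cosT0 R) -power_cos.
  under eq_bigr do under eq_bigr do rewrite addr0.
  over.
rewrite exchange_big mulr_sumr; apply: eq_bigr => a _ /=.
rewrite exchange_big (bigD1 a)//= -mulr_sumr sum_cosE subrr eqxx mul1r.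
rewrite big1 ?addr0 => [|b ba]; first by rewrite mulrC -expr2.
by rewrite -mulr_sumr sum_cosE subr_eq0 eq_sym (negPf ba) mul0r mulr0.
Qed.

(** Fourier inversion for a fourfold convolution: the right side counts, with weights, the ways of
    writing [- m] as [a - b + (c - d)]. *)
Lemma sum_power_cos m : \sum_x power x ^+ 2 * cosT (xi x m) =
  #|A|%:R * \sum_a \sum_b \sum_c \sum_d
    F a * F b * (F c * F d) * (a - b + (c - d) + m == 0)%:R.
Proof.
under eq_bigr => x _.
  rewrite expr2 -mulrA -power_cos mulr_sumr.
  under eq_bigr => a _.
    rewrite mulr_sumr.
    under eq_bigr => b _.
      rewrite mulrCA -power_cos mulr_sumr.
      under eq_bigr => c _.
        rewrite mulr_sumr.
        under eq_bigr => d _.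
          rewrite addrA -!raddfD mulrA.
          over.
        over.
      over.
    over.
  over.
rewrite /= exchange_big mulr_sumr; apply: eq_bigr => a _ /=.
rewrite exchange_big mulr_sumr; apply: eq_bigr => b _ /=.
rewrite exchange_big mulr_sumr; apply: eq_bigr => c _ /=.
rewrite exchange_big mulr_sumr; apply: eq_bigr => d _ /=.
by rewrite -mulr_sumr sum_cosE [c - d + _]addrC mulrA mulrC.
Qed.

Hypothesis F01 : forall a, 0 <= F a <= 1.

Lemma sum_power_le : \sum_x power x <= #|A|%:R ^+ 2.
Proof.
rewrite sum_power expr2 ler_pM2l; last by rewrite ltr0n; apply/card_gt0P; exists 0.
rewrite -sumr_const ler_sum// => a _.
by have /andP[F0 F1] := F01 a; rewrite exprn_ile1.
Qed.

(** Chebyshev's inequality applied to Parseval's; the bound does not depend on [A]. *)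
Lemma card_large_power (tau : R) : 0 < tau ->
  #|[set x | tau * #|A|%:R ^+ 2 <= power x]%SET|%:R <= tau^-1.
Proof.
move=> tau0; have A0 : 0 < #|A|%:R ^+ 2 :> R.
  by rewrite exprn_gt0// ltr0n; apply/card_gt0P; exists 0.
set S := [set x | _]%SET.
rewrite -div1r ler_pdivlMr// -(ler_pM2r A0) mul1r -mulrA mulr_natl.
apply: le_trans sum_power_le; rewrite -sumr_const.
apply: (@le_trans _ _ (\sum_(x in S) power x)).
  by apply: ler_sum => x; rewrite inE.
rewrite [leRHS](bigID (mem S))/= lerDl sumr_ge0// => x _.
exact: power_ge0.
Qed.

(** Translating [F] by [m] rotates its Fourier coefficient by [xi x m], so
    [power x * (1 - cosT (xi x m))] is a correlation of [F] with the small function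
    [F a - F (a - m)]. *)
Lemma large_power_translate x m (tau eta : R) :
  tau * #|A|%:R ^+ 2 <= power x -> (forall a, `|F (a - m) - F a| <= eta) ->
  tau * (1 - cosT (xi x m)) <= eta.
Proof.
move=> tx Fm; have A0 : 0 < #|A|%:R ^+ 2 :> R.
  by rewrite exprn_gt0// ltr0n; apply/card_gt0P; exists 0.
rewrite -(ler_pM2r A0) mulrAC.
have c1 : 0 <= 1 - cosT (xi x m) by rewrite subr_ge0 cosT_le1.
apply: (@le_trans _ _ (power x * (1 - cosT (xi x m)))); first exact: ler_wpM2r.
have -> : power x * (1 - cosT (xi x m)) =
    \sum_a \sum_b (F a - F (a - m)) * F b * cosT (xi x (a - b)).
  rewrite mulrBr -{1}(@cosT0 R) -!power_cos.
  rewrite [X in _ - X](reindex_inj (addIr (- m))) -sumrB/=.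
  apply: eq_bigr => a _; rewrite -sumrB; apply: eq_bigr => b _.
  by rewrite addr0 -raddfD addrAC subrK !mulrBl.
have -> : eta * #|A|%:R ^+ 2 = \sum_(a : A) \sum_(b : A) eta.
  by rewrite !sumr_const -mulrnA expr2 -natrM mulr_natr.
apply: ler_sum => a _; apply: ler_sum => b _.
apply: le_trans (ler_norm _) _; rewrite !normrM distrC -[leRHS]mulr1.
have /andP[Fb0 Fb1] := F01 b.
rewrite -mulrA ler_pM ?mulr_ge0// (ger0_norm Fb0) mulr_ile1//.
by rewrite ler_norml cosT_geN1 cosT_le1.
Qed.

(** In [\sum_x power x ^+ 2 * cosT (xi x m)] the trivial character contributes at least
    [kappa ^+ 4 * #|A| ^+ 4], the other large coefficients something nonnegative, and by Parseval
    the small ones at least minus half that bound. So the sum is positive, and so is some term of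
    its fourfold expansion. *)
Lemma bogolyubov m (kappa : R) : 0 < kappa -> kappa * #|A|%:R <= \sum_a F a ->
  (forall x, kappa ^+ 4 / 2 * #|A|%:R ^+ 2 <= power x -> 0 <= cosT (xi x m)) ->
  exists a b c d, [/\ 0 < F a, 0 < F b, 0 < F c, 0 < F d & a - b + (c - d) + m = 0].
Proof.
move=> k0 kF cm.
have A0 : 0 < #|A|%:R :> R by rewrite ltr0n; apply/card_gt0P; exists 0.
have F0 a : 0 <= F a by have /andP[] := F01 a.
set tau := kappa ^+ 4 / 2 in cm.
have tau0 : 0 < tau by rewrite divr_gt0// exprn_gt0.
have Px0 : kappa ^+ 4 * #|A|%:R ^+ 4 <= power x0 ^+ 2.
  rewrite -exprMn (exprM _ 2 2) lerXn2r ?nnegrE ?sqr_ge0 ?power_ge0//.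
  rewrite /power [X in X ^+ 2 + _](_ : _ = \sum_a F a); last first.
    by apply: eq_bigr => a _; rewrite xi0 cosT0 mulr1.
  apply: (@le_trans _ _ ((\sum_a F a) ^+ 2)); last by rewrite lerDl sqr_ge0.
  by rewrite lerXn2r ?nnegrE ?mulr_ge0 ?sumr_ge0// ltW.
have pos : 0 < \sum_x power x ^+ 2 * cosT (xi x m).
  rewrite (bigD1 x0)//= xi0 cosT0 mulr1.
  have : - (tau * #|A|%:R ^+ 2 * \sum_x power x) <=
      \sum_(x | x != x0) power x ^+ 2 * cosT (xi x m).
    apply: (@le_trans _ _ (- (tau * #|A|%:R ^+ 2 * \sum_(x | x != x0) power x))).
      rewrite lerN2 ler_pM2l; last by rewrite mulr_gt0// exprn_gt0.
      by rewrite [leRHS](bigD1 x0)//= lerDr power_ge0.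
    rewrite mulr_sumr -sumrN; apply: ler_sum => x _.
    have := power_ge0 x; have := cosT_geN1 (xi x m).
    have t0 : 0 <= tau * #|A|%:R ^+ 2 by rewrite mulr_ge0 ?exprn_ge0// ltW.
    case: (leP (tau * #|A|%:R ^+ 2) (power x)) => [/cm|] h1 h2 h3.
      have : 0 <= power x ^+ 2 * cosT (xi x m) by rewrite mulr_ge0// sqr_ge0.
      have := mulr_ge0 t0 h3; lra.
    move: h1 h2 h3 t0; move: (tau * _) (power x) (cosT _) => t p c h1 h2 h3 t0.
    have : 0 <= t + p * c by nra.
    by move=> /(mulr_ge0 h3); rewrite expr2; lra.
  have := sum_power_le; have : tau * #|A|%:R ^+ 4 < kappa ^+ 4 * #|A|%:R ^+ 4.
    rewrite ltr_pM2r ?exprn_gt0// /tau.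
    by rewrite ltr_pdivrMr// ltr_pMr ?exprn_gt0// ltr1n.
  have : 0 < tau * #|A|%:R ^+ 2 by rewrite mulr_gt0// exprn_gt0.
  rewrite (exprD _ 2 2); nra.
move: pos; rewrite sum_power_cos pmulr_rgt0//.
have T0 a b c d : 0 <= F a * F b * (F c * F d) * (a - b + (c - d) + m == 0)%:R.
  by rewrite !mulr_ge0.
have ex (G : A -> R) : (forall i, 0 <= G i) -> 0 < \sum_i G i -> exists i, 0 < G i.
  move=> G0 /lt0r_neq0/eqP; rewrite /= => /psumr_neq0P[//|i /=]; by exists i.
case/ex => [a|a]; first by do 3 (apply: sumr_ge0 => ? _).
case/ex => [b|b]; first by do 2 (apply: sumr_ge0 => ? _).
case/ex => [c|c]; first by apply: sumr_ge0 => ? _.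
case/ex => [d|d]; first exact: T0.
move=> /lt0r_neq0; rewrite !mulf_eq0 !negb_or pnatr_eq0 eqb0 negbK.
move=> /andP[/andP[/andP[Fa Fb] /andP[Fc Fd]] /eqP abcd].
by exists a, b, c, d; split; rewrite // lt0r ?Fa ?Fb ?Fc ?Fd F0.
Qed.

End FiniteFourier.

(** * Bohr neighbourhoods in precompact groups *)

Section Bump.
Variables (R : realType) (P : topologicalZmodType) (E W : set P) (K : nat).
Hypothesis WN : forall x, W x -> W (- x).
Hypothesis K_gt0 : (0 < K)%N.

Definition layer (k : nat) : set P := [set x | exists e s,
  [/\ E e, (size s <= k)%N, (forall w, w \in s -> W w) & x = e + \sum_(w <- s) w]].

(** A discrete Urysohn function: 1 on [E] and 0 outside [layer K]. Translation by an element of [W]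
    moves [layer k] into [layer k.+1], hence changes the average by at most [1 / K]. *)
Definition bump (x : P) : R := K%:R^-1 * \sum_(0 <= k < K) `[< layer k x >]%:R.

Lemma bump_ge0 x : 0 <= bump x.
Proof. by rewrite mulr_ge0 ?invr_ge0 ?sumr_ge0. Qed.

Lemma bump_le1 x : bump x <= 1.
Proof.
rewrite /bump ler_pdivrMl ?ltr0n// mulr1 -[leRHS](_ : \sum_(0 <= k < K) 1 = _).
  by apply: ler_sum => k _; rewrite lern1 leq_b1.
by rewrite sumr_const_nat subn0.
Qed.

Lemma bump_eq1 x : E x -> bump x = 1.
Proof.
move=> Ex; rewrite /bump (eq_bigr (fun=> 1)).
  by rewrite ?sumr_const_nat subn0 mulVf// pnatr_eq0 -lt0n.
move=> k _; suff /asboolT -> : layer k x by [].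
by exists x, [::]; split=> //; rewrite big_nil addr0.
Qed.

Lemma bump_gt0 x : 0 < bump x -> layer K x.
Proof.
apply: contraPP => nKx; rewrite /bump big_nat_cond big1 ?mulr0 ?ltxx// => k.
rewrite andbT => /andP[_ kK]; case: asboolP => // -[e [s [Ee sk sW xE]]].
by exfalso; apply: nKx; exists e, s; split=> //; exact: leq_trans sk (ltnW kK).
Qed.

Lemma bump_lip x y : W (y - x) -> `|bump y - bump x| <= K%:R^-1.
Proof.
have half u v : W (v - u) -> bump u - bump v <= K%:R^-1.
  move=> Wvu; rewrite -mulrBr ler_pdivrMl ?ltr0n// mulfV ?pnatr_eq0 -?lt0n//.
  rewrite lerBlDr; apply: (@le_trans _ _ (\sum_(0 <= k < K) `[< layer k.+1 v >]%:R)).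
    apply: ler_sum => k _; case: asboolP => // -[e [s [Ee sk sW uE]]].
    suff /asboolT -> : layer k.+1 v by [].
    exists e, (v - u :: s); split=> //.
      by move=> w; rewrite inE => /orP[/eqP->//|]; exact: sW.
    by rewrite big_cons addrCA -uE subrK.
  rewrite -(prednK K_gt0) big_nat_recr//= [X in _ <= _ + X]big_nat_recl//=.
  rewrite addrCA [leRHS]addrCA [leLHS]addrC lerD//.
    by case: asboolP; rewrite ?ler0n.
  by rewrite lerDr//; case: asboolP.
move=> Wyx; have h1 := half _ _ Wyx.
have h2 : bump y - bump x <= K%:R^-1 by apply: half; rewrite -opprB; exact: WN.
by rewrite ler_norml; apply/andP; split; lra.
Qed.

End Bump.

(** Pigeonhole: the points that [theta] sends near a given [y], once translated by one of them, land
    in the preimage of [E]; the [y] in [ys] account for all of [A]. *)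
Lemma card_translate_le (A : finZmodType) (P : zmodType) (theta : A -> P)
    (E0 E : set P) (ys : seq P) :
  (forall p, exists2 y, y \in ys & E0 (p - y)) ->
  (forall y a b, E0 (theta a - y) -> E0 (theta b - y) -> E (theta (a - b))) ->
  (#|A| <= size ys * #|[pred a | `[< E (theta a) >]]|)%N.
Proof.
move=> cover E0E.
pose S y := [set a | `[< E0 (theta a - y) >]]%SET.
have SE y : (#|S y| <= #|[pred a | `[< E (theta a) >]]|)%N.
  have [->|[b]] := set_0Vmem (S y); first by rewrite cards0.
  rewrite inE => /asboolP Eb.
  rewrite -(card_imset (S y) (addIr (- b))); apply/subset_leq_card/fintype.subsetP => c.
  move=> /imsetP[a]; rewrite inE => /asboolP Ea ->.
  by rewrite inE; do 2?[apply/asboolP]; exact: (E0E _ _ _ Ea Eb).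
have -> : #|A| = (\sum_(a : A) 1)%N by rewrite sum1_card.
apply: (@leq_trans (\sum_(a : A) \sum_(y <- ys) (a \in S y))).
  apply: leq_sum => a _; have [y yys Ey] := cover (theta a).
  rewrite lt0n sum_nat_seq_neq0; apply/hasP; exists y => //=.
  by rewrite inE eqb0 negbK; exact/asboolP.
rewrite exchange_big /= (@leq_trans (\sum_(y <- ys) #|[pred a | `[< E (theta a) >]]|))//.
  apply: leq_sum => y _; apply: leq_trans (SE y).
  by rewrite -sum1_card [leqRHS]big_mkcond/= leq_sum// => a _; case: (_ \in _).
by rewrite big_const_seq count_predT iter_addn_0 mulnC.
Qed.

(** Uniformity in [A] is the point: the number of translates covering [P] bounds from below the
    density [kappa] of the bump function, hence [tau], and so fixes [B], [W] and [V] in advance. *)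
Lemma bohr_finite (R : realType) (P : topologicalZmodType) (U : set P) :
  precompact_group P -> nbhs 0 U ->
  exists B (W V : set P), [/\ nbhs 0 W, nbhs 0 V &
  forall (A : finZmodType) (X : finType) (xi : X -> {additive A -> circle R})
    (x0 : X) (theta : A -> P),
  (forall a, xi x0 a = 0) -> #|X| = #|A| ->
  (forall a, a != 0 -> \sum_x cosT (xi x a) = 0 :> R) ->
  (forall a b, V (theta a + theta b - theta (a + b))) ->
  exists lg : seq X, [/\ (size lg <= B)%N, x0 \in lg,
    (forall x m, x \in lg -> W (theta m) -> 2^-1 <= cosT (xi x m)) &
    (forall m, (forall x, x \in lg -> 0 <= cosT (xi x m)) -> U (theta m))]].
Proof.
move=> hP U0.
(* Seven terms: the image of [(b - a) + (d - c)] is made of four values of [theta] and three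
   additivity errors. Below, 2 is for a point of [E] plus a sum from [W], and 3 for two differences
   and one error. *)
have [U1 [U10 U1N U1U]] := nbhs0_sum 7 U0.
have [E [E0 EN EU]] := nbhs0_sum 2 U10.
have [E1 [E10 E1N E1E]] := nbhs0_sum 3 E0.
have [ys cover] := precompact_cover hP E10.
have ys0 : 0 < (size ys)%:R :> R.
  by rewrite ltr0n; case: ys cover => // /(_ 0)[].
pose kappa : R := (size ys)%:R^-1.
have kappa0 : 0 < kappa by rewrite invr_gt0.
have kappa1 : kappa <= 1 by rewrite invf_le1// ler1n -(ltr0n R).
pose tau := kappa ^+ 4 / 2.
have tau0 : 0 < tau by rewrite divr_gt0// exprn_gt0.
(* The bump then varies by at most [tau / 2] along [W], which makes [1 - cosT (xi x m)] at most 1/2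
   for the large coefficients. *)
pose K := (Num.truncn (2 / tau)).+1.
have KR0 : 0 < K%:R :> R by rewrite ltr0n.
have Ktau : K%:R^-1 <= tau / 2.
  have : 2 / tau < K%:R by exact: truncnS_gt.
  by rewrite ltr_pdivrMr// -div1r ler_pdivrMr//; lra.
have [W [W0 WN WE]] := nbhs0_sum K E0.
have [W1 [W10 W1N W1W]] := nbhs0_sum 2 W0.
exists (Num.truncn tau^-1), W1, (W1 `&` (E1 `&` U1)); split=> //.
  by apply: filterI => //; exact: filterI.
move=> A X xi x0 theta xi0 cardX xi_orth thetaV.
have A0 : 0 < #|A|%:R :> R by rewrite ltr0n; apply/card_gt0P; exists 0.
pose F a : R := bump R E W K (theta a).
have F01 a : 0 <= F a <= 1 by rewrite bump_ge0 bump_le1.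
have thetaD a b : exists v, [/\ W1 v, E1 v, U1 v & theta (a + b) = theta a + theta b - v].
  exists (theta a + theta b - theta (a + b)).
  by have [? [? ?]] := thetaV a b; split=> //; rewrite subKr.
have thetaB a b : exists v, [/\ W1 v, E1 v, U1 v & theta (a - b) = theta a - theta b + v].
  have [v [? ? ? vE]] := thetaD (a - b) b; exists v; split=> //.
  by rewrite subrK in vE; rewrite vE addrAC subrK addrK.
have sumF : kappa * #|A|%:R <= \sum_a F a.
  rewrite ler_pdivrMl//.
  have : (#|A| <= size ys * #|[pred a | `[< E (theta a) >]]|)%N.
    apply: (card_translate_le cover) => y a b Ea Eb.
    have [v [_ E1v _ ->]] := thetaB a b.
    rewrite (_ : _ + v = \sum_(z <- [:: theta a - y; - (theta b - y); v]) z); last first.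
      by rewrite !big_cons big_nil addr0 addrA opprB addrA subrK.
    by apply: E1E => // z; rewrite !inE => /or3P[] /eqP -> //; exact: E1N.
  rewrite -(ler_nat R) => /le_trans; apply; rewrite natrM ler_pM2l//.
  rewrite -sum1_card natr_sum big_mkcond/= ler_sum// => a _.
  rewrite inE; case: asboolP => [/bump_eq1|_]; last by have /andP[] := F01 a.
  by rewrite /F => ->.
pose lg := enum [set x | tau * #|A|%:R ^+ 2 <= power xi F x]%SET.
have lgP x : (x \in lg) = (tau * #|A|%:R ^+ 2 <= power xi F x) by rewrite mem_enum inE.
exists lg; split.
- rewrite -ltnS -(ltr_nat R) -cardE; apply: le_lt_trans _ (truncnS_gt _).
  exact: card_large_power.
(* The coefficient at [x0] is the sum of [F], and [kappa ^+ 4 / 2 <= kappa ^+ 2]. Having [x0] in the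
   list will allow padding with it. *)
- rewrite lgP.
  apply: (@le_trans _ _ ((\sum_a F a) ^+ 2)).
    apply: (@le_trans _ _ ((kappa * #|A|%:R) ^+ 2)).
      rewrite exprMn ler_pM2r ?exprn_gt0//.
      have : kappa ^+ 4 <= kappa ^+ 2 by rewrite ler_wiXn2l// ltW.
      have : 0 < kappa ^+ 2 by rewrite exprn_gt0.
      by rewrite /tau; lra.
    have S0 : 0 <= \sum_a F a.
      by apply: sumr_ge0 => a _; have /andP[] := F01 a.
    have k0 : 0 <= kappa * #|A|%:R by rewrite mulr_ge0// ltW.
    exact: lerXn2r sumF.
  rewrite /power -[leLHS]addr0 lerD ?sqr_ge0//.
  rewrite [leRHS](_ : _ = (\sum_a F a) ^+ 2)//; congr (_ ^+ 2).
  by apply: eq_bigr => a _; rewrite xi0 cosT0 mulr1.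
- move=> x m; rewrite lgP => xl Wm.
  have := large_power_translate F01 (m := m) xl (eta := tau / 2).
  have step a : `|F (a - m) - F a| <= tau / 2.
    apply: le_trans Ktau; apply: bump_lip => //.
    have [v [W1v _ _ ->]] := thetaB a m.
    rewrite (_ : _ - theta a = \sum_(z <- [:: - theta m; v]) z); last first.
      by rewrite !big_cons big_nil addr0 addrAC [theta a + _]addrC addrK addrC.
    by apply: W1W => // z; rewrite !inE => /orP[] /eqP ->//; exact: W1N.
  move=> /(_ step); rewrite ler_pM2l//; lra.
move=> m cosm.
have [|a [b [c [d [Fa Fb Fc Fd abcd]]]]] :=
    @bogolyubov _ _ _ xi x0 xi0 cardX xi_orth F F01 m kappa kappa0 sumF.
  by move=> x; rewrite -lgP; exact: cosm.
have FU1 e : 0 < F e -> U1 (theta e).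
  move=> /bump_gt0[u [s [Eu sK sW ->]]].
  rewrite (_ : u + _ = \sum_(z <- [:: u; \sum_(w <- s) w]) z); last first.
    by rewrite !big_cons big_nil addr0.
  by apply: EU => // z; rewrite !inE => /orP[] /eqP -> //; exact: WE.
have -> : m = (b - a) + (d - c).
  move/eqP: abcd; rewrite addrC addr_eq0 => /eqP ->.
  by rewrite opprD !opprB.
have [v1 [_ _ Uv1 ->]] := thetaD (b - a) (d - c).
have [v2 [_ _ Uv2 ->]] := thetaB b a.
have [v3 [_ _ Uv3 ->]] := thetaB d c.
rewrite (_ : _ - v1 = \sum_(z <-
  [:: theta b; - theta a; v2; theta d; - theta c; v3; - v1]) z); last first.
  by rewrite !big_cons big_nil addr0 !addrA.
apply: U1U => // z; rewrite !inE.
do 6! [move=> /orP[/eqP->|]; first by [|exact: FU1|apply: U1N; exact: FU1]].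
by move=> /eqP ->; exact: U1N.
Qed.

(** * Characters of the groups [(Z/N)^r], and almost homomorphisms out of them *)

HB.instance Definition _ (I : finType) (V : finZmodType) :=
  GRing.Zmodule.on {ffun I -> V}.

Section CyclicPower.
Variables (R : realType) (r n : nat).
Local Notation N := n.+2.
Local Notation A := {ffun 'I_r -> 'I_n.+2}.
Implicit Types (u v : 'I_n.+2) (k m : A).

Definition cyclic_char (u : 'I_n.+2) : circle R := toT (u%:R / N%:R).

Lemma cyclic_charD u v : cyclic_char (u + v) = cyclic_char u + cyclic_char v.
Proof.
have N0 : (N%:R : R) != 0 by rewrite pnatr_eq0.
rewrite /cyclic_char -toTD -mulrDl -natrD.
have -> : nat_of_ord (u + v) = ((nat_of_ord u + nat_of_ord v) %% N)%N by [].
move: (nat_of_ord u + _)%N => s; apply/esym/toTP/RintP; exists (s %/ N)%:Z.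
by rewrite {1}(divn_eq s N) natrD natrM mulrDl mulfK// addrK -pmulrn.
Qed.

Lemma cyclic_char_is_additive : zmod_morphism cyclic_char.
Proof.
by move=> u v; apply/eqP; rewrite eq_sym subr_eq -cyclic_charD subrK.
Qed.

HB.instance Definition _ :=
  GRing.isZmodMorphism.Build 'I_n.+2 (circle R) cyclic_char cyclic_char_is_additive.

Lemma cyclic_char_neq0 u : u != 0 -> cyclic_char u <> 0.
Proof.
move=> u0; rewrite /cyclic_char -toT0 => /toTP/RintP[z].
rewrite subr0 => uz.
have u1 : (0 < u)%N by rewrite lt0n; apply: contra_neq u0 => u0; apply: val_inj.
have N0 : 0 < N%:R :> R by rewrite ltr0n.
have : 0 < (z%:~R : R) < 1.
  by rewrite -uz divr_gt0 ?ltr0n//= ltr_pdivrMr// mul1r ltr_nat.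
rewrite ltr0z -[1 : R]/(1%:~R) ltr_int; lia.
Qed.

(** The pairing [k . m / N] modulo 1, symmetric in [k] and [m], which lets [A] index its own
    characters. *)
Definition torus_char k m : circle R := \sum_j cyclic_char (k j * m j).

Lemma torus_charC k m : torus_char k m = torus_char m k.
Proof. by apply: eq_bigr => j _; rewrite mulrC. Qed.

Fact torus_char_is_additive k : zmod_morphism (torus_char k).
Proof.
move=> m m'; rewrite /torus_char -sumrB; apply: eq_bigr => j _.
by rewrite !ffunE mulrBr raddfB.
Qed.

HB.instance Definition _ k :=
  GRing.isZmodMorphism.Build A (circle R) (torus_char k) (torus_char_is_additive k).

Lemma torus_char0 m : torus_char 0 m = 0.
Proof. by rewrite torus_charC raddf0. Qed.

(* Translating the sum by [k0] and by [- k0] multiplies it by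
   [cos (torus_char k0 m)], which is not 1 for a suitable [k0]. *)
Lemma torus_char_orth m : m != 0 -> \sum_k cosT (torus_char k m) = 0 :> R.
Proof.
move=> m0.
have [j mj] : exists j, m j != 0.
  apply/existsP; rewrite -negb_forall; apply: contra m0 => /forallP m0.
  by apply/eqP/ffunP => j; rewrite ffunE; exact/eqP/m0.
pose k0 : A := [ffun i => (i == j)%:R].
have k0m : torus_char k0 m <> 0.
  rewrite /torus_char (bigD1 j)//= ffunE eqxx mul1r big1 ?addr0.
    exact: cyclic_char_neq0.
  by move=> i /negPf ij; rewrite ffunE ij mul0r raddf0.
have c1 : 1 - cosT (torus_char k0 m) != 0 :> R.
  by rewrite subr_eq0 eq_sym; apply/eqP => /cosT_eq1.
set S := \sum_k _.
have Sp : S = \sum_k cosT (torus_char k m + torus_char k0 m).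
  rewrite /S (reindex_inj (addIr k0)); apply: eq_bigr => k _.
  by rewrite !(torus_charC _ m) raddfD.
have Sm : S = \sum_k cosT (torus_char k m - torus_char k0 m).
  rewrite /S (reindex_inj (addIr (- k0))); apply: eq_bigr => k _.
  by rewrite !(torus_charC _ m) raddfB.
have : S + S = 2 * cosT (torus_char k0 m) * S.
  rewrite {1}Sp {1}Sm -big_split mulr_sumr; apply: eq_bigr => k _ /=.
  by rewrite cosTD cosTB; ring.
move=> SS; have : (1 - cosT (torus_char k0 m)) * S = 0 by lra.
by move/eqP; rewrite mulf_eq0 (negPf c1) => /eqP.
Qed.

End CyclicPower.

(** Additivity of [theta] fails only through carries: each coordinate drops [n.+2] at most once, at
    the cost of one [a j *+ n.+2]. *)
Lemma torus_combD (P : topologicalZmodType) (r n : nat) (a : 'I_r -> P) (V V' : set P) :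
  (forall s : seq P, (size s <= r)%N -> (forall x, x \in s -> V' x) ->
    V (\sum_(x <- s) x)) ->
  V' 0 -> (forall j, V' (a j *+ n.+2)) ->
  let theta (m : {ffun 'I_r -> 'I_n.+2}) := \sum_j a j *+ m j in
  forall m m', V (theta m + theta m' - theta (m + m')).
Proof.
move=> V'V V'0 V'a theta m m'.
pose q j := ((nat_of_ord (m j) + nat_of_ord (m' j)) %/ n.+2)%N.
have -> : theta m + theta m' - theta (m + m') =
    \sum_(x <- [seq a j *+ n.+2 *+ q j | j <- enum 'I_r]) x.
  rewrite big_map big_enum /theta -big_split -sumrB /=; apply: eq_bigr => j _.
  rewrite ffunE -mulrnDr.
  have -> : nat_of_ord (m j + m' j) =
      ((nat_of_ord (m j) + nat_of_ord (m' j)) %% n.+2)%N by [].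
  by rewrite {1}(divn_eq (_ + _)%N n.+2) mulrnDr addrK mulnC mulrnA.
apply: V'V; first by rewrite size_map size_enum_ord.
move=> x /mapP[j _ ->].
have : (q j < 2)%N.
  rewrite ltn_divLR//; have := ltn_ord (m j); have := ltn_ord (m' j); lia.
by case: (q j) => [|[|//]] _; [exact: V'0|exact: V'a].
Qed.

(** Pigeonhole on the cells of a finite cover visited by the multiples of all [a j] at once. Only
    even multiples are used, so that two distinct ones differ by at least 2. *)
Lemma precompact_recurrence (P : topologicalZmodType) (U : set P) r (a : 'I_r -> P) :
  precompact_group P -> nbhs 0 U -> exists n, forall j, U (a j *+ n.+2).
Proof.
move=> hP U0; have [V V0 VU] := nbhs0_sub U0.
have [ys cover] := precompact_cover hP V0.
pose y p := s2val (cid2 (cover p)).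
have yP p : (y p \in ys) && `[< V (p - y p) >].
  by rewrite /y; case: cid2 => z /= -> /asboolP ->.
have yV p : V (p - y p) by have /andP[_ /asboolP] := yP p.
pose I := {ffun 'I_r -> 'I_(size ys).+1}.
pose col (i : 'I_#|I|.+1) : I := [ffun j => inord (index (y (a j *+ (2 * i))) ys)].
have /injectivePn[i [i' ii' cii']] : ~~ injectiveb col.
  apply/injectiveP => /leq_card.
  by rewrite card_ord ltnn.
wlog lt_ii' : i i' ii' cii' / (i < i')%N.
  move=> W; have /orP[] : (i < i')%N || (i' < i)%N by rewrite -neq_ltn.
    exact: W.
  by apply: W; rewrite 1?eq_sym.
exists (2 * (i' - i)).-2 => j.
have -> : (2 * (i' - i)).-2.+2 = (2 * i' - 2 * i)%N by lia.
rewrite mulrnBr; last by rewrite leq_mul2l ltnW.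
have yy : y (a j *+ (2 * i)) = y (a j *+ (2 * i')).
  have ylt p : (index (y p) ys < (size ys).+1)%N by rewrite ltnS index_size.
  have /ffunP/(_ j) := cii'; rewrite !ffunE => /(congr1 val); rewrite /= !inordK// => e.
  have /andP[y1 _] := yP (a j *+ (2 * i)); have /andP[y2 _] := yP (a j *+ (2 * i')).
  by rewrite -(nth_index 0 y1) e nth_index.
have := VU _ _ (yV (a j *+ (2 * i'))) (yV (a j *+ (2 * i))).
by rewrite yy opprB addrA subrK.
Qed.

(* [B] and [W] do not depend on [s]: compactness can be applied as [s] grows. *)
Lemma bohr_approx (R : realType) (P : topologicalZmodType) (U : set P) :
  precompact_group P -> nbhs 0 U ->
  exists B (W : set P), nbhs 0 W /\ forall (s : seq P) (n : nat),
  exists c : 'I_B -> P -> circle R, [/\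
    (forall i x y, x \in s -> y \in s -> x + y \in s -> forall j, (j <= n)%N ->
      2^-1 <= cosT ((c i (x + y) - (c i x + c i y)) *+ 2 ^ j)),
    (forall i x, x \in s -> W x -> 2^-1 <= cosT (c i x)) &
    (forall x, x \in s -> (forall i, 0 <= cosT (c i x)) -> U x)].
Proof.
move=> hP U0.
have [B [W [V [W0 V0 bohr]]]] := bohr_finite R hP U0.
exists B, W; split=> // s n.
(* [2 ^ n] copies of the additivity defect, each costing three terms in [V1]. *)
have [V1 [V10 V1N V1W]] := nbhs0_sum (3 * 2 ^ n) W0.
have [V2 [V20 _ V2V]] := nbhs0_sum (size s) (filterI V0 V10).
pose a (j : 'I_(size s)) : P := nth 0 s j.
have [N aN] := precompact_recurrence a hP V20.
pose A := {ffun 'I_(size s) -> 'I_N.+2}.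
pose theta (m : A) : P := \sum_j a j *+ m j.
have thetaV : forall m m', (V `&` V1) (theta m + theta m' - theta (m + m')).
  exact: torus_combD V2V (nbhs_singleton V20) aN.
have [|lg [lgB lg0 lgW lgU]] := bohr A A (@torus_char R _ _) 0 theta
    (@torus_char0 R _ _) erefl (@torus_char_orth R _ _).
  by move=> m m'; have [] := thetaV m m'.
(* The basis vector that [theta] sends to [x]; through it the characters of [A] become functions on
   [s]. *)
pose e x : A := [ffun j : 'I_(size s) => (nat_of_ord j == index x s)%:R].
have theta_e x : x \in s -> theta (e x) = x.
  move=> xs; have ix : (index x s < size s)%N by rewrite index_mem.
  rewrite /theta (bigD1 (Ordinal ix))//= ffunE eqxx mulr1n /a nth_index//.
  rewrite big1 ?addr0// => j /negPf jx.
  by rewrite ffunE (_ : (_ == _) = false)// -jx -val_eqE.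
(* The default 0 is the trivial character, a member of [lg], so padding to exactly [B] characters
   imposes nothing new. *)
exists (fun i x => torus_char R (nth 0 lg i) (e x)).
have lgi i : nth 0 lg i \in lg.
  by have [il|il] := ltnP i (size lg); [exact: mem_nth|rewrite nth_default].
split.
- move=> i x y xs ys xys j jn.
  rewrite -raddfD -raddfB -raddfMn; apply: lgW => //.
  set d := e (x + y) - (e x + e y).
  have theta0 : theta 0 = 0 by rewrite /theta big1// => k _; rewrite ffunE mulr0n.
  have [w1 w2] : V1 (theta (e x) + theta (e y) - theta (e x + e y)) /\
      V1 (theta d + theta (e x + e y) - theta (e (x + y))).
    have [_ w1] := thetaV (e x) (e y); have [_ w2] := thetaV d (e x + e y).
    by rewrite subrK in w2.
  have thd : theta d = (theta (e x) + theta (e y) - theta (e x + e y)) +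
      (theta d + theta (e x + e y) - theta (e (x + y))).
    by rewrite !theta_e// addrC addrA subrK addrK.
  (* [d] need not be 0, but [theta] nearly kills its multiples: each further copy adds the two terms
     of [theta d] and one additivity error. *)
  have ind q : exists l : seq P, [/\ (size l <= 3 * q)%N,
      (forall w, w \in l -> V1 w) & theta (d *+ q) = \sum_(w <- l) w].
    elim: q => [|q [l [lq lV lE]]]; first by exists [::]; rewrite big_nil.
    have [_ v] := thetaV d (d *+ q).
    exists [:: theta (e x) + theta (e y) - theta (e x + e y),
      theta d + theta (e x + e y) - theta (e (x + y)),
      - (theta d + theta (d *+ q) - theta (d + d *+ q)) & l]; split.
    + by rewrite /= mulnS -ltnS; lia.
    + move=> w; rewrite !inE => /or4P[/eqP->|/eqP->|/eqP->|]//; first exact: V1N.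
      exact: lV.
    have alg (t t' t'' : P) : t + (- (t + t' - t'') + t') = t''.
      by rewrite opprB opprD !addrA subrK addrAC subrr add0r.
    by rewrite !big_cons -lE mulrS [RHS]addrA -thd alg.
  have [l [l3 lV ->]] := ind (2 ^ j)%N.
  apply: V1W => //; apply: leq_trans l3 _.
  by rewrite leq_mul2l leq_exp2l.
- by move=> i x xs Wx; apply: lgW => //; rewrite theta_e.
move=> x xs cx; rewrite -(theta_e x xs); apply: lgU => k klg.
have kB : (index k lg < B)%N by apply: leq_trans lgB; rewrite index_mem.
by have := cx (Ordinal kB); rewrite /= nth_index.
Qed.

(** * From finite approximations to continuous characters, by compactness *)

Lemma cluster_ge (R : realType) (X : topologicalType) (F : set_system X) (p : X)
    (phi : X -> R) (c : R) :
  continuous phi -> cluster F p -> F [set q | c <= phi q] -> c <= phi p.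
Proof.
move=> cphi Fp Fc; rewrite leNgt; apply/negP => pc.
have : nbhs p [set q | phi q < c].
  apply: open_nbhs_nbhs; split=> //.
  by move/continuousP: cphi => /(_ _ (@open_lt R c)); exact.
move=> /(Fp _ _ Fc)[q [/= cq qc]].
by move: cq; rewrite leNgt qc.
Qed.

(** At a cluster point of the finite approximations all weak inequalities persist. Those on the
    multiples by [2 ^ j] force exact additivity, as the circle has no small subgroups, and those on
    [W] give continuity. *)
Theorem bohr_neighbourhood (R : realType) (P : topologicalZmodType) (U : set P) :
  precompact_group P -> nbhs 0 U ->
  exists B (chi : 'I_B -> dual R P),
    forall x, (forall i, 0 < cosT (chi i x)) -> U x.
Proof.
move=> hP U0; have [B [W [W0 approx]]] := bohr_approx R hP U0.
pose X := prod_topology (fun _ : 'I_B * P => circle R).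
pose good (q : seq P * nat) : set X := [set f |
    [/\ (forall i x y, x \in q.1 -> y \in q.1 -> x + y \in q.1 ->
      forall j, (j <= q.2)%N ->
      2^-1 <= cosT ((f (i, x + y) - (f (i, x) + f (i, y))) *+ 2 ^ j)),
    (forall i x, x \in q.1 -> W x -> 2^-1 <= cosT (f (i, x))) &
    (forall x, x \in q.1 -> (forall i, 0 <= cosT (f (i, x))) -> U x)]].
pose F : set_system X := filter_from setT good.
have FF : ProperFilter F.
  apply: filter_from_proper; last first.
    move=> [s n] _; have [c [ca cb cc]] := approx s n.
    by exists (fun p => c p.1 p.2).
  apply: filter_fromT_filter; first by exists ([::], 0%N).
  move=> [s n] [s' n']; exists (s ++ s', maxn n n') => f /= [fa fb fc].
  split; split=> /=.
  - move=> i x y xs ys xys j jn.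
    by apply: fa; rewrite ?mem_cat ?xs ?ys ?xys// leq_max jn.
  - by move=> i x xs; apply: fb; rewrite mem_cat xs.
  - by move=> x xs; apply: fc; rewrite mem_cat xs.
  - move=> i x y xs ys xys j jn.
    by apply: fa; rewrite ?mem_cat ?xs ?ys ?xys ?orbT// leq_max jn orbT.
  - by move=> i x xs; apply: fb; rewrite mem_cat xs orbT.
  - by move=> x xs; apply: fc; rewrite mem_cat xs orbT.
have Fgood q : F (good q) by exists q.
have /(_ F FF) := @tychonoff ('I_B * P)%type (fun=> circle R) (fun=> setT)
  (fun=> @circle_compact R).
have /[swap]/[apply] : F [set f : X | forall i, [set: circle R] (f i)].
  by apply: filterS (filterT) => f _.
move=> [f [_ Ff]].
have proj_cont p : continuous (fun g : X => g p).
  exact: (@proj_continuous _ (fun=> circle R) p).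
have cosT_cont (g : X -> circle R) : continuous g -> continuous (cosT \o g).
  by move=> cg x; apply: continuous_comp; [exact: cg|exact: cosT_continuous].
have fD i x y : f (i, x + y) = f (i, x) + f (i, y).
  apply/eqP; rewrite -subr_eq0; apply/eqP; apply: cosT_no_small_subgroup => j.
  pose phi (g : X) := (g (i, x + y) - (g (i, x) + g (i, y))) *+ 2 ^ j.
  apply: (@cluster_ge _ _ _ _ (cosT \o phi) _ _ Ff).
    apply: cosT_cont; apply: continuous_mulrn; apply: continuous_subr => //.
    exact: continuous_addr.
  apply: filterS (Fgood ([:: x; y; x + y], j)) => g [ga _ _].
  by apply: ga; rewrite //= !inE eqxx ?orbT.
have fW i x : W x -> 2^-1 <= cosT (f (i, x)).
  move=> Wx; apply: (@cluster_ge _ _ _ _ (cosT \o (fun g : X => g (i, x))) _ _ Ff).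
    exact: cosT_cont.
  by apply: filterS (Fgood ([:: x], 0%N)) => g [_ gb _]; apply: gb; rewrite //= inE.
have f_add i : zmod_morphism (fun x => f (i, x)).
  by move=> x y; apply/eqP; rewrite eq_sym subr_eq -fD subrK.
pose h i : {additive P -> circle R} :=
  HB.pack (fun x => f (i, x)) (GRing.isZmodMorphism.Build P (circle R) _ (f_add i)).
have hc i : continuous (h i).
  by apply: (@additive_circle_continuous _ _ (h i) W W0) => x; exact: fW.
exists B, (fun i => Dual (hc i)) => x cx.
(* The last condition of [good] is an implication, so it is used on an approximation instead: the
   strict inequalities at [f] are open and hold at some [g] good for [x]. *)
have : nbhs (f : X) [set g : X | forall i, 0 < cosT (g (i, x))].
  apply: (@filter_forall X 'I_B (fun i => [set g : X | 0 < cosT (g (i, x))])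
    (nbhs (f : X))) => i.
  apply: open_nbhs_nbhs; split; last exact: cx.
  have /cosT_cont/continuousP/(_ _ (@open_gt R 0)) := proj_cont (i, x).
  exact.
move=> /(Ff _ _ (Fgood ([:: x], 0%N)))[g [[_ _ gc] gx]].
by apply: gc => [|i]; [rewrite /= inE|exact/ltW/gx].
Qed.

(** * Separating filter-bases *)

(** Equality in the circle is the countable conjunction of [1 - 1/(k+1) < cosT] of the difference;
    [f] numbers the characters, so each [O m k] involves at most one of them. *)
Lemma Gdelta_equalizer (R : realType) (P : topologicalZmodType)
    (A : set (dual R P)) (x : P) : countable A ->
  Gdelta [set y | forall chi, A chi -> chi y = chi x].
Proof.
move=> /countable_injP[f finj].
pose O m k := [set y | forall chi, A chi -> f chi = m ->
  1 - k.+1%:R^-1 < cosT (chi y - chi x)].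
have oO m k : open (O m k).
  have [[chi [Achi fchi]]|no] := pselect (exists chi, A chi /\ f chi = m); last first.
    rewrite (_ : O m k = setT); first exact: openT.
    by apply/seteqP; split=> // y _ chi Achi fchi; exfalso; apply: no; exists chi.
  rewrite (_ : O m k =
      (fun y => cosT (chi y - chi x)) @^-1` [set z | 1 - k.+1%:R^-1 < z]).
    apply: open_comp; last exact: open_gt.
    move=> y _; apply: (@continuous_comp _ _ _ (fun y => chi y - chi x) cosT).
      apply: (@continuous_subr _ _ chi (fun=> chi x)); first exact: dual_continuous.
      by move=> z; exact: cvg_cst.
    exact: cosT_continuous.
  apply/seteqP; split=> y /=; first by move=> /(_ chi Achi fchi).
  move=> yO chi' Achi' fchi'; rewrite (finj chi' chi) ?inE ?fchi//.
exists (fun n => if choice.unpickle n is Some (m, k) then O m k else setT).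
  by move=> n; case: choice.unpickle => [[m k]|]; [exact: oO|exact: openT].
apply/seteqP; split=> y /= yx.
  move=> n _; case: choice.unpickle => [[m k]|]// chi Achi _.
  by rewrite yx// subrr cosT0 ltrBlDr ltrDl invr_gt0.
move=> chi Achi; apply/eqP; rewrite -subr_eq0; apply/eqP/cosT_eq1/eqP.
rewrite eq_le cosT_le1/=; apply/ler_addgt0Pr => e e0.
have [k ke] : exists k, k.+1%:R^-1 < e.
  exists (Num.truncn e^-1); rewrite -[ltRHS]invrK ltf_pV2 ?posrE ?invr_gt0//.
  exact: truncnS_gt.
have := yx (choice.pickle (f chi, k)) I.
rewrite /= choice.pickleK => /(_ chi Achi erefl) /= h.
by rewrite -lerBlDr (le_trans _ (ltW h))// lerD2l lerN2 ltW.
Qed.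

(** * Integer combinations of a sequence of characters *)

Section Evaluation.
Variables (R : realType) (P : topologicalZmodType) (D : nat -> dual R P).
Implicit Types (a : {poly int}) (y : P).

(** [{poly int}] serves as a countable free abelian group with basis ['X^j], mapped to [D j]. *)
Definition poly_char a y : circle R := \sum_(j < size a) D j y *~ a`_j.

Lemma poly_char_widen a y n : (size a <= n)%N ->
  poly_char a y = \sum_(j < n) D j y *~ a`_j.
Proof.
move=> an; rewrite /poly_char (big_ord_widen n (fun j => D j y *~ a`_j) an).
rewrite big_mkcond; apply: eq_bigr => j _; case: ltnP => // aj.
by rewrite nth_default// mulr0z.
Qed.

Lemma poly_char_Xn j y : poly_char 'X^j y = D j y.
Proof.
rewrite /poly_char size_polyXn big_ord_recr/= coefXn eqxx mulr1z big1 ?add0r//.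
by move=> i _; rewrite coefXn ltn_eqF ?ltn_ord// mulr0z.
Qed.

Fact poly_char_is_additive a : zmod_morphism (poly_char a).
Proof.
move=> y z; rewrite /poly_char -sumrB; apply: eq_bigr => j _.
by rewrite raddfB mulrzBl.
Qed.

HB.instance Definition _ a :=
  GRing.isZmodMorphism.Build P (circle R) (poly_char a) (poly_char_is_additive a).

(** The same pairing with the roles exchanged: a point of [P] becomes a character of
    [{poly int}]. *)
Definition poly_eval y a : circle R := poly_char a y.

Fact poly_eval_is_additive y : zmod_morphism (poly_eval y).
Proof.
move=> a b; rewrite /poly_eval.
pose n := maxn (size (a - b)) (maxn (size a) (size b)).
rewrite !(@poly_char_widen _ _ n) ?leq_max ?leqnn ?orbT// -sumrB.
by apply: eq_bigr => j _; rewrite coefB mulrzBr.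
Qed.

HB.instance Definition _ y :=
  GRing.isZmodMorphism.Build {poly int} (circle R) (poly_eval y) (poly_eval_is_additive y).

Lemma poly_char_continuous a : continuous (poly_char a).
Proof.
apply: continuous_sumr => j; apply: continuous_mulrz; exact: dual_continuous.
Qed.

Definition poly_dual a : dual R P :=
  @Dual R P (poly_char a) (@poly_char_continuous a).

End Evaluation.

Lemma zero_continuous (R : realType) (P : topologicalZmodType) :
  continuous (\0 : {additive P -> circle R}).
Proof. by move=> x; exact: cvg_cst. Qed.

Section Separation.
Variables (R : realType) (P : topologicalZmodType) (H : set P) (x : P).
Variables (D : nat -> dual R P).
Hypotheses (H0 : H 0) (HB : forall y z, H y -> H z -> H (y - z)).
Hypothesis xNH : forall y, H y -> exists j, D j y <> D j x.

Definition separating_set (q : seq P * R) : set (dual R P) :=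
  [set chi | exists a, [/\ chi = poly_dual D a,
    (forall y, y \in q.1 -> 1 - q.2 < cosT (chi y)) & cosT (chi x) <= 2^-1]].

Definition separating_base : set (set (dual R P)) :=
  separating_set @` [set q : seq P * R | (forall y, y \in q.1 -> H y) /\ 0 < q.2].

(** An integer combination of evaluations at points of [H] is the evaluation at a point of [H],
    which differs from that at [x] on some ['X^j]. So [character_not_near_span] applies to
    characters of [{poly int}]. *)
Lemma separating_set_nonempty (q : seq P * R) :
  (forall y, y \in q.1 -> H y) -> 0 < q.2 -> separating_set q !=set0.
Proof.
case: q => s e /= sH e0.
pose h (i : 'I_(size s)) : {additive {poly int} -> circle R} :=
  poly_eval D (nth 0 s i).
have hH i : H (nth 0 s i).
  by have [il|il] := ltnP i (size s); [exact/sH/mem_nth|rewrite nth_default].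
have HN y : H y -> H (- y) by move=> Hy; rewrite -sub0r; exact: HB.
have HD y z : H y -> H z -> H (y + z).
  by move=> Hy /HN; rewrite -[z in y + z]opprK; exact: HB.
have HMn y n : H y -> H (y *+ n).
  by move=> Hy; elim: n => // n IH; rewrite mulrS; exact: HD.
have HMz y (m : int) : H y -> H (y *~ m).
  by move=> Hy; case: m => n; [exact: HMn|apply/HN/HMn].
have xNspan (k : 'I_(size s) -> int) :
    exists a, poly_eval D x a <> \sum_i h i a *~ k i.
  apply: contrapT => no.
  pose y := \sum_(i < size s) nth 0 s i *~ k i.
  have Hy : H y by apply: (big_ind H) => // i _; exact: HMz.
  have [j] := xNH Hy; apply; rewrite -!(poly_char_Xn D).
  have E : poly_eval D x 'X^j = \sum_i h i 'X^j *~ k i.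
    by apply: contrapT => ne; apply: no; exists 'X^j.
  rewrite -[RHS]/(poly_eval D x 'X^j) E /y raddf_sum; apply: eq_bigr => i _.
  by rewrite raddfMz.
have [a [ha xa]] := character_not_near_span xNspan e0.
exists (poly_dual D a), a; split=> // y /= ys.
have ix : (index y s < size s)%N by rewrite index_mem.
by have := ha (Ordinal ix); rewrite /= nth_index.
Qed.

Lemma separating_base_countable : countable_filter_bases separating_base.
Proof.
split.
  split.
  - by exists (separating_set ([::], 1)), ([::], 1).
  - by move=> _ [q [qH q0] <-]; exact: separating_set_nonempty.
  - move=> _ _ [[s e] [/= sH e0] <-] [[s' e'] [/= sH' e0'] <-].
    exists (separating_set (s ++ s', Num.min e e')).
      exists (s ++ s', Num.min e e') => //=; split; last by rewrite lt_min e0.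
      by move=> y; rewrite mem_cat => /orP[/sH|/sH'].
    move=> _ [a [-> ha xa]]; split; exists a; split=> // y ys.
      apply: le_lt_trans (ha y _); last by rewrite /= mem_cat ys.
      by rewrite lerD2l lerN2 ge_min lexx.
    apply: le_lt_trans (ha y _); last by rewrite /= mem_cat ys orbT.
    by rewrite lerD2l lerN2 ge_min lexx orbT.
exists (separating_set ([::], 1)); first by exists ([::], 1).
apply: (@sub_countable _ _ _ [set poly_dual D a | a in setT]).
  by apply: subset_card_le => _ [a [-> _ _]]; exists a.
apply: sub_countable (card_image_le _ _) _.
exact: countableP.
Qed.

Lemma separating_base_cvg y : H y -> z_set separating_base y.
Proof.
move=> Hy U /nbhs_circle0[e e0 eU].
exists (separating_set ([:: y], e)).
  by exists ([:: y], e) => //=; split=> // z; rewrite inE => /eqP->.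
by move=> _ [chi [a [-> ha _]] <-]; apply: eU; apply: ha; rewrite /= inE.
Qed.

Lemma separating_base_ncvg : ~ z_set separating_base x.
Proof.
move=> /(_ [set z | 2^-1 < cosT z])[].
  by apply: open_nbhs_nbhs; split; [exact: open_cosT_gt|rewrite /= cosT0; lra].
move=> _ [q [qH q0] <-] qx.
have [chi qchi] := separating_set_nonempty qH q0.
have : 2^-1 < cosT (chi x) by apply: qx; exists chi.
by rewrite ltNge; case: qchi => a [_ _ ->].
Qed.

End Separation.

Theorem theorem3p1 (R : realType) (P : topologicalZmodType)
  (hP : precompact_group P) (hausP : hausdorff_space P)
  (H : set P) (hH : GRing.zmod_closed (mem H)) :
  frak_l R H = Gdelta_closure H.
Proof.
have [/set_mem H0 hB] := hH.
have HB y z : H y -> H z -> H (y - z).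
  by move=> Hy Hz; apply/set_mem; apply: hB; exact/mem_set.
apply/seteqP; split=> x.
  move=> xl S [V oV SE] Sx; apply: contrapT => SH.
  have Ox n : nbhs x (V n).
    by apply: open_nbhs_nbhs; split=> //; move: Sx; rewrite SE; exact.
  have bohr n : {B & {chi : 'I_B -> dual R P |
      forall u, (forall i, 0 < cosT (chi i u)) -> V n (x + u)}}.
    have /cid[B /cid[chi chiP]] := bohr_neighbourhood R hP (nbhs0_addr (Ox n)).
    by exists B, chi.
  pose chi0 : dual R P := Dual (@zero_continuous R P).
  (* All characters of all the [bohr n] in one sequence, indexed by codes of pairs [(n, i)]; [chi0]
     fills the remaining places. *)
  pose D j := if choice.unpickle j is Some (n, i)
    then if insub i is Some i' then sval (projT2 (bohr n)) i' else chi0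
    else chi0.
  (* If [y] agreed with [x] under every [D j], then [y - x] would be killed by all the characters of
     each [bohr n], so [y] would lie in every [V n], hence in [S]. *)
  have xNH y : H y -> exists j, D j y <> D j x.
    move=> Hy; apply: contrapT => no; apply: SH; exists y; split=> //.
    rewrite SE => n _; rewrite -[y](subrK x) addrC.
    apply: (svalP (projT2 (bohr n))) => i.
    rewrite raddfB.
    have -> : sval (projT2 (bohr n)) i y = sval (projT2 (bohr n)) i x.
      apply: contrapT => ne; apply: no.
      exists (choice.pickle (n, nat_of_ord i)).
      by rewrite /D choice.pickleK valK.
    by rewrite subrr cosT0.
  apply: (separating_base_ncvg H0 HB xNH); apply: xl; split.
    exact: separating_base_countable.
  by move=> y; exact: separating_base_cvg.
(* A point [h] of [H] agrees with [x] on the countable member [A]; on members of [FF] inside [A] the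
   images at [x] and at [h] coincide, so convergence at [h] passes to [x]. *)
move=> xH FF [[[_ FF0 FFI] [A FFA cA]] Hz].
have [h [hx Hh]] : [set y | forall chi, A chi -> chi y = chi x] `&` H !=set0.
  by apply: xH => //; exact: Gdelta_equalizer.
move=> U U0; have [B FFB BU] := Hz h Hh U U0.
have [C FFC CAB] := FFI A B FFA FFB.
exists C => // _ [chi Cchi <-]; have [Achi Bchi] := CAB _ Cchi.
by rewrite -(hx _ Achi); apply: BU; exists chi.
Qed.
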